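(* Let $\kappa\geq\omega$ be a cardinal number. Let $X$ and $Y$ be $\kappa$-compact Tychonoff spaces. Assume there exists a continuous linear map $T:C_p(X)\to C_p(Y)$ such that the image of $T$ is dense in $C_p(Y)$. If $X$ is strongly $\kappa$-dimensional, then $Y$ is strongly $\kappa$-dimensional as well.
   Context: All topological spaces are Tychonoff (completely regular Hausdorff). $C_p(X)$ is the space of real-valued continuous functions on $X$ with the topology of pointwise convergence. Dimension means the covering dimension $\dim$. For an infinite cardinal $\kappa$: a space is strongly $\kappa$-dimensional if it is the union of a family, indexed by $\kappa$, of closed subspaces each of finite covering dimension; a space is $\kappa$-compact if it is the union of a family, indexed by $\kappa$, of compact subspaces. *)

(* Defs.v *)
From HB Require Import structures.
From mathcomp Require Import all_boot all_order all_algebra.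
From mathcomp Require Import all_classical all_reals all_analysis.

Set Implicit Arguments.
Unset Strict Implicit.
Unset Printing Implicit Defensive.

Import Order.TTheory GRing.Theory Num.Theory.
Import numFieldNormedType.Exports.

Local Open Scope classical_set_scope.
Local Open Scope card_scope.
Local Open Scope ring_scope.

Definition tychonoff_space (T : topologicalType) : Prop :=
  completely_regular_space T /\ hausdorff_space T.

(* [continuousType X R] carries no global topology; the alias [Cp R X] is the
   same type with the pointwise operations and, as a subspace of
   [{ptws X -> R}], the topology of pointwise convergence. *)
Definition Cp (R : realType) (X : topologicalType) : Type := continuousType X R.

Section Cp_structure.
Context {R : realType} {X : topologicalType}.
Implicit Types (f g : Cp R X) (a : R).

HB.instance Definition _ := Choice.on (Cp R X).

HB.instance Definition _ := Topological.copy (Cp R X)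
  (initial_topology ((fun f => f : X -> R) : Cp R X -> {ptws X -> R})).

Let cst_continuous0 : continuous (fun _ : X => 0 : R).
Proof. exact: cst_continuous. Qed.

Let opp_continuous_fct f : continuous (fun x => - f x).
Proof. by move=> x; apply: cvgN; exact: (@cts_fun _ _ f). Qed.

Let add_continuous_fct f g : continuous (fun x => f x + g x).
Proof. by move=> x; apply: cvgD; exact: (@cts_fun _ _ _). Qed.

Let scale_continuous_fct a f : continuous (fun x => a * f x).
Proof.
by move=> x; apply: cvgM; [exact: cvg_cst | exact: (@cts_fun _ _ f)].
Qed.

Definition Cp_zero : Cp R X := mkcts cst_continuous0.
Definition Cp_opp f : Cp R X := mkcts (opp_continuous_fct (f := f)).
Definition Cp_add f g : Cp R X := mkcts (add_continuous_fct (f := f) (g := g)).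
Definition Cp_scale a f : Cp R X :=
  mkcts (scale_continuous_fct (a := a) (f := f)).

Let Cp_addA : associative Cp_add.
Proof. by move=> f g h; apply/continuousEP => x; exact: addrA. Qed.

Let Cp_addC : commutative Cp_add.
Proof. by move=> f g; apply/continuousEP => x; exact: addrC. Qed.

Let Cp_add0 : left_id Cp_zero Cp_add.
Proof. by move=> f; apply/continuousEP => x; exact: add0r. Qed.

Let Cp_addN : left_inverse Cp_zero Cp_opp Cp_add.
Proof. by move=> f; apply/continuousEP => x; exact: addNr. Qed.

HB.instance Definition _ :=
  GRing.isZmodule.Build (Cp R X) Cp_addA Cp_addC Cp_add0 Cp_addN.

Let Cp_scaleA a b f : Cp_scale a (Cp_scale b f) = Cp_scale (a * b) f.
Proof. by apply/continuousEP => x; exact: mulrA. Qed.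

Let Cp_scale1 : left_id 1 Cp_scale.
Proof. by move=> f; apply/continuousEP => x; exact: mul1r. Qed.

Let Cp_scaleDr : right_distributive Cp_scale +%R.
Proof. by move=> a f g; apply/continuousEP => x; exact: mulrDr. Qed.

Let Cp_scaleDl f : {morph Cp_scale^~ f : a b / a + b}.
Proof. by move=> a b; apply/continuousEP => x; exact: mulrDl. Qed.

HB.instance Definition _ := GRing.Zmodule_isLmodule.Build R (Cp R X)
  Cp_scaleA Cp_scale1 Cp_scaleDr Cp_scaleDl.

End Cp_structure.

Section covering_dimension.
Context (R : realType) {T : topologicalType}.
Implicit Types (U V : set T) (C D : set (set T)).

Definition functionally_open U : Prop :=
  exists2 f : T -> R, continuous f & U = [set x | f x != 0].

Definition finite_functionally_open_cover C : Prop :=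
  [/\ finite_set C, C `<=` functionally_open & \bigcup_(U in C) U = [set: T]].

Definition refines D C : Prop :=
  forall V, D V -> exists2 U, C U & V `<=` U.

(* Order at most [n]: no point lies in more than [n + 1] members. *)
Definition order_le (n : nat) C : Prop :=
  forall x : T, C `&` [set U | U x] #<= `I_n.+1.

End covering_dimension.

(* For Tychonoff spaces dim is defined with covers by functionally open
   (cozero) sets; when [T] is normal this is the dimension defined with
   arbitrary open covers. *)
Definition dim_le (R : realType) (n : nat) (T : topologicalType) : Prop :=
  forall C : set (set T), finite_functionally_open_cover R C ->
  exists D : set (set T),
    [/\ finite_functionally_open_cover R D, refines D C & order_le n D].

(* The empty space, of dimension -1, satisfies [dim_le R 0]. *)
Definition finite_dim (R : realType) (T : topologicalType) : Prop :=
  exists n : nat, dim_le R n T.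

(* A cardinal is represented by a type [K] of that cardinality. *)
Definition strongly_kappa_dimensional (R : realType) (K : Type)
    (T : topologicalType) : Prop :=
  exists F : K -> set T,
    [/\ forall k, closed (F k),
        forall k, finite_dim R (set_type (F k)) &
        \bigcup_k F k = [set: T]].

Definition kappa_compact (K : Type) (T : topologicalType) : Prop :=
  exists F : K -> set T,
    (forall k, compact (F k)) /\ \bigcup_k F k = [set: T].

(* Main.v *)
Require Import Defs.
From HB Require Import structures.
From mathcomp Require Import all_boot all_order all_algebra.
From mathcomp Require Import all_classical all_reals all_analysis.
From mathcomp Require Import finmap ring lra zify.

Set Implicit Arguments.
Unset Strict Implicit.
Unset Printing Implicit Defensive.

Import Order.TTheory GRing.Theory Num.Theory.
Import numFieldNormedType.Exports.

Local Open Scope classical_set_scope.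
Local Open Scope card_scope.
Local Open Scope ring_scope.

(* Every functional [f |-> T f y] is a finite combination of evaluations at the
   points of a finite set [supp y] of [X], and density of the range means that
   distinct points of [Y] give distinct functionals. The conditions
   "[supp y] has at most [m] points", "[supp y] lies in the closed set [F]" and
   "the functional has norm at most [r]" are closed in [y], so [Y] is a union
   of [K] many compact sets on which [m], [r] and a compact finite-dimensional
   [F] are fixed. On a compact set of points whose supports have exactly [m]
   elements, [supp y] and its coefficients depend continuously on [y] and
   determine it; products of fine covers of [F] and of [-r, r] of bounded order
   therefore pull back to fine covers whose order is bounded in terms of [m] and
   the dimension of [F] only. The strata for [0, ..., m] are then glued with the
   crude estimate that orders of covers add up, since only finiteness of the
   dimension matters. *)

(** * Infinite cardinals are idempotent *)

Definition embeds (T U : Type) (A : set T) (B : set U) : Prop :=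
  exists f : T -> U, {in A &, injective f} /\ forall x, A x -> B (f x).

(** Zorn's lemma for partial injections from [A] to [B], encoded as graphs: a maximal one exhausts
    [A] or exhausts [B], since otherwise one more pair could be added. *)
Lemma embeds_total (K : Type) (A B : set K) : embeds A B \/ embeds B A.
Proof.
pose P (G : set (K * K)) :=
  [/\ forall x z, G (x, z) -> A x /\ B z,
      forall x z z', G (x, z) -> G (x, z') -> z = z' &
      forall x x' z, G (x, z) -> G (x', z) -> x = x'].
have [] := @Zorn_bigcup _ P.
  move=> F FP tot; split.
  - by move=> x z [G FG Gxz]; have [+ _ _] := FP _ FG; exact.
  - move=> x z z' [G FG Gxz] [H FH Hxz].
    have [GH|HG] := tot _ _ FG FH.
      by have [_ + _] := FP _ FH; apply; [exact: GH Gxz|].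
    by have [_ + _] := FP _ FG; apply; [exact: Gxz|exact: HG].
  - move=> x z z' [G FG Gxz] [H FH Hxz].
    have [GH|HG] := tot _ _ FG FH.
      by have [_ _ +] := FP _ FH; apply; [exact: GH Gxz|].
    by have [_ _ +] := FP _ FG; apply; [exact: Gxz|exact: HG].
move=> G [[GAB Gfun Ginj] maxG].
have [domG|/existsNP[a]] := pselect (forall x, A x -> exists z, G (x, z)).
  left; have /choice[f fG] : forall x, exists z, A x -> G (x, z).
    by move=> x; have [/domG[z]|nA] := pselect (A x); [exists z|exists x].
  exists f; split=> [x y /set_mem Ax /set_mem Ay fxy|x Ax].
    by apply: (Ginj _ _ (f x)); [exact: fG|rewrite fxy; exact: fG].
  by have [] := GAB _ _ (fG _ Ax).
move=> /not_implyP[Aa nGa].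
have [codG|/existsNP[b]] := pselect (forall z, B z -> exists x, G (x, z)).
  right; have /choice[f fG] : forall z, exists x, B z -> G (x, z).
    by move=> z; have [/codG[x]|nB] := pselect (B z); [exists x|exists z].
  exists f; split=> [x y /set_mem Bx /set_mem By fxy|x Bx].
    by apply: (Gfun (f x)); [exact: fG|rewrite fxy; exact: fG].
  by have [] := GAB _ _ (fG _ Bx).
move=> /not_implyP[Bb nGb]; exfalso.
apply: (maxG (G `|` [set (a, b)])).
  split; first by left.
  by move=> /(_ (a, b) (or_intror erefl)) Gab; apply: nGa; exists b.
split.
- by move=> x z [/GAB //|[-> ->]].
- move=> x z z' [Gz|e] [Gz'|e'].
  + exact: Gfun Gz Gz'.
  + by exfalso; apply: nGa; exists z; case: e' Gz => <-.
  + by exfalso; apply: nGa; exists z'; case: e Gz' => <-.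
  + by case: e => _ ->; case: e'.
- move=> x x' z [Gz|e] [Gz'|e'].
  + exact: Ginj Gz Gz'.
  + by exfalso; apply: nGb; exists x; case: e' Gz => _ <-.
  + by exfalso; apply: nGb; exists x'; case: e Gz' => _ <-.
  + by case: e => -> _; case: e'.
Qed.

Lemma nat_card_leP (K : Type) :
  [set: nat] #<= [set: K] -> exists f : nat -> K, injective f.
Proof.
move=> /card_leP/unsquash f.
exists (fun n => set_val (f (SigSub (mem_set (I : [set: nat] n))))) => m n.
move=> /val_inj fmn.
have /(congr1 val) := @inj _ _ _ f _ _ (mem_set I) (mem_set I) fmn.
by [].
Qed.

(** The graph of an injection [S * S -> S] in which [S] is not named but recovered as the set of [x]
    with [(x, x)] in the domain. As a property of a bare set of triples it is suited to Zorn's lemma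
    for unions of chains. *)
Definition pairing_graph (K : Type) (G : set ((K * K) * K)) : Prop :=
  [/\ forall x y z, G ((x, y), z) ->
        [/\ exists w, G ((x, x), w), exists w, G ((y, y), w) &
            exists w, G ((z, z), w)],
      forall x y u v, G ((x, x), u) -> G ((y, y), v) ->
        exists w, G ((x, y), w),
      forall p z z', G (p, z) -> G (p, z') -> z = z' &
      forall p p' z, G (p, z) -> G (p', z) -> p = p'].

(** Each clause involves at most two triples, and in a chain both lie in the larger graph. *)
Lemma pairing_graph_bigcup (K : Type) (F : set (set ((K * K) * K))) :
  F `<=` @pairing_graph K -> total_on F subset ->
  pairing_graph (\bigcup_(G in F) G).
Proof.
move=> FP tot; split.
- move=> x y z [G FG Gxyz]; have [+ _ _ _] := FP _ FG.
  by move=> /(_ _ _ _ Gxyz)[[a ?] [b ?] [c ?]]; split;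
    [exists a|exists b|exists c]; exists G.
- move=> x y u v [G FG Gx] [H FH Hy].
  have [GH|HG] := tot _ _ FG FH.
    have [_ + _ _] := FP _ FH => /(_ _ _ _ _ (GH _ Gx) Hy)[w ?].
    by exists w; exists H.
  have [_ + _ _] := FP _ FG => /(_ _ _ _ _ Gx (HG _ Hy))[w ?].
  by exists w; exists G.
- move=> p z z' [G FG Gz] [H FH Hz].
  have [GH|HG] := tot _ _ FG FH.
    by have [_ _ + _] := FP _ FH; apply; [exact: GH Gz|].
  by have [_ _ + _] := FP _ FG; apply; [exact: Gz|exact: HG].
- move=> p p' z [G FG Gz] [H FH Hz].
  have [GH|HG] := tot _ _ FG FH.
    by have [_ _ _ +] := FP _ FH; apply; [exact: GH Gz|].
  by have [_ _ _ +] := FP _ FG; apply; [exact: Gz|exact: HG].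
Qed.

Definition pairing_on (K : Type) (S : set K) (f : K * K -> K) : Prop :=
  (forall x y, S x -> S y -> S (f (x, y))) /\
  forall x y x' y', S x -> S y -> S x' -> S y' ->
    f (x, y) = f (x', y') -> x = x' /\ y = y'.

Definition graph_on (K : Type) (S : set K) (f : K * K -> K) :
  set ((K * K) * K) := [set p | [/\ S p.1.1, S p.1.2 & p.2 = f p.1]].

Lemma graph_on_pairing (K : Type) (S : set K) (f : K * K -> K) :
  pairing_on S f -> pairing_graph (graph_on S f).
Proof.
move=> [fS fI]; split.
- move=> x y z [/= Sx Sy ->]; split; eexists; split=> //=; exact: fS.
- by move=> x y u v [/= Sx _ _] [/= Sy _ _]; exists (f (x, y)).
- by move=> p z z' [/= _ _ ->] [/= _ _ ->].
- move=> [x y] [x' y'] z [/= Sx Sy ->] [/= Sx' Sy' e].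
  by have [-> ->] := fI _ _ _ _ Sx Sy Sx' Sy' e.
Qed.

(** Back from graphs to functions; [k] is the default value outside the domain. *)
Lemma pairing_graphE (K : Type) (k : K) (G : set ((K * K) * K)) :
  pairing_graph G ->
  exists f, pairing_on [set x | exists w, G ((x, x), w)] f /\
    G = graph_on [set x | exists w, G ((x, x), w)] f.
Proof.
move=> [Gdom Gtot Gfun Ginj].
have /choice[f fG] : forall p, exists z, (exists w, G (p, w)) -> G (p, z).
  by move=> p; have [[w Gw]|nG] := pselect (exists w, G (p, w));
    [exists w|exists k].
have fG' x y : (exists w, G ((x, x), w)) -> (exists w, G ((y, y), w)) ->
    G ((x, y), f (x, y)).
  by move=> [u Gu] [v Gv]; apply/fG/Gtot; [exact: Gu|exact: Gv].
exists f; split; first split.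
- by move=> x y Sx Sy; have [] := Gdom _ _ _ (fG' _ _ Sx Sy).
- move=> x y x' y' Sx Sy Sx' Sy' e.
  by have := fG' _ _ Sx Sy; rewrite e => /Ginj/(_ (fG' _ _ Sx' Sy'))[-> ->].
- apply/seteqP; split=> [[[x y] z] Gz|[[x y] z] [/= Sx Sy ->]]; last exact: fG'.
  have [Sx Sy _] := Gdom _ _ _ Gz; split=> //=.
  by apply: Gfun Gz _; exact: fG'.
Qed.

(* The three new blocks [S' * S], [S * S'], [S' * S'] of the enlarged square,
   [S' = g S] being a disjoint copy of [S], are sent into [S'] with the tags
   [a], [b], [c]. *)
Lemma pairing_on_extend (K : Type) (S : set K) (f : K * K -> K)
    (g : K -> K) (a b c : K) :
  pairing_on S f ->
  {in S &, injective g} -> (forall x, S x -> ~ S (g x)) ->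
  S a -> S b -> S c -> a <> b -> a <> c -> b <> c ->
  exists F, pairing_on (S `|` g @` S) F /\
    forall x y, S x -> S y -> F (x, y) = f (x, y).
Proof.
move=> [fS fI] ginj gS Sa Sb Sc ab ac bc.
have gI x y : S x -> S y -> g x = g y -> x = y.
  by move=> Sx Sy /ginj; apply; exact: mem_set.
(* [r x] is the representative of [x] in [S]: [x] itself on [S], its preimage under [g] on the
   copy. *)
have /choice[r rP] : forall x, exists s, (S `|` g @` S) x ->
    S s /\ (S x /\ s = x \/ ~ S x /\ x = g s).
  move=> x; have [[Sx|[s Ss <-]]|nS] := pselect ((S `|` g @` S) x).
  - by exists x => _; split=> //; left.
  - by exists s => _; split=> //; right; split=> //; exact: gS.
  - by exists x.
pose tag x y := if `[< S x >] then b else if `[< S y >] then a else c.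
pose F p := if `[< S p.1 >] && `[< S p.2 >] then f p
  else g (f (tag p.1 p.2, f (r p.1, r p.2))).
have Stag x y : S (tag x y) by rewrite /tag; case: ifP => // _; case: ifP.
have FE x y : S x -> S y -> F (x, y) = f (x, y).
  by move=> Sx Sy; rewrite /F /= !asboolT.
have rI x x' : (S `|` g @` S) x -> (S `|` g @` S) x' -> `[< S x >] = `[< S x' >] ->
    r x = r x' -> x = x'.
  move=> /rP[_ hx] /rP[_ hx'] xx'.
  have E : S x <-> S x' := asbool_eq_equiv xx'.
  case: hx => [[Sx ->]|[nSx xE]]; case: hx' => [[Sx' ->]|[nSx' xE']] //.
  - by case: nSx'; apply: E.1.
  - by case: nSx; apply: E.2.
  - by move=> rxx'; rewrite xE rxx' -xE'.
exists F; split=> //; split.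
  move=> x y Sx Sy; rewrite /F /=.
  have [Srx _] := rP _ Sx; have [Sry _] := rP _ Sy.
  case: ifPn => [/andP[/asboolP ? /asboolP ?]|_]; first by left; exact: fS.
  right; exists (f (tag x y, f (r x, r y))) => //.
  by exact: (fS _ _ (Stag _ _) (fS _ _ Srx Sry)).
move=> x y x' y' Sx Sy Sx' Sy'; rewrite /F /=.
have [Srx _] := rP _ Sx; have [Sry _] := rP _ Sy.
have [Srx' _] := rP _ Sx'; have [Sry' _] := rP _ Sy'.
have Sg u v w z : S w -> S z -> S (f (tag u v, f (w, z))).
  by move=> ? ?; apply: (fS) => //; exact: fS.
case: ifPn => [/andP[/asboolP ? /asboolP ?]|hxy];
  case: ifPn => [/andP[/asboolP ? /asboolP ?]|hxy'].
- exact: fI.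
- move=> e; exfalso; apply: (gS (f (tag x' y', f (r x', r y')))); first exact: Sg.
  by rewrite -e; exact: fS.
- move=> e; exfalso; apply: (gS (f (tag x y, f (r x, r y)))); first exact: Sg.
  by rewrite e; exact: fS.
move=> e.
have [et] := fI _ _ _ _ (Stag x y) (fS _ _ Srx Sry) (Stag x' y')
  (fS _ _ Srx' Sry') (gI _ _ (Sg x y _ _ Srx Sry) (Sg x' y' _ _ Srx' Sry') e).
move=> /(fI _ _ _ _ Srx Sry Srx' Sry')[ex ey].
suff [e1 e2] : `[< S x >] = `[< S x' >] /\ `[< S y >] = `[< S y' >].
  by split; exact: rI.
(* Outside [S * S] the distinct tags tell the three new blocks apart, so equal tags give equal
   memberships in [S]. *)
move: et hxy hxy'; rewrite /tag.
by do 4 case: `[< _ >] => //=; move=> *; congruence.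
Qed.

(** Take a maximal pairing graph above a pairing of a countable set, with underlying set [S]. An
    embedding of [S] into its complement would allow an extension, so the complement embeds into
    [S]; then [K] embeds into [S] and inherits its pairing. *)
Lemma infinite_pairing (K : Type) :
  [set: nat] #<= [set: K] -> exists f : K * K -> K, injective f.
Proof.
move=> /nat_card_leP[i iinj].
pose k := i 0%N.
pose S0 := range i.
have [i' i'K] : exists i' : K -> nat, forall n, i' (i n) = n.
  have /choice[h hP] : forall x, exists n, forall m, x = i m -> n = m.
    move=> x; have [[n e]|nx] := pselect (exists n, x = i n).
      by exists n => m; rewrite e => /iinj.
    by exists 0%N => m e; case: nx; exists m.
  by exists h => n; exact: hP.
pose f0 (p : K * K) := i (choice.pickle (i' p.1, i' p.2)).
have f0P : pairing_on S0 f0.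
  split=> [x y _ _|_ _ _ _ [m _ <-] [n _ <-] [m' _ <-] [n' _ <-]].
    by exists (choice.pickle (i' x, i' y)).
  rewrite /f0 /= !i'K => /iinj/(pcan_inj (@choice.pickleK _)).
  by case=> -> ->.
(* The alternative [G = set0] is there for the empty chain; maximality excludes it below. *)
pose P G := pairing_graph G /\ (G = set0 \/ graph_on S0 f0 `<=` G).
have [] := @Zorn_bigcup _ P.
  move=> F FP tot; split.
    by apply: pairing_graph_bigcup => // G /FP[].
  have [[G [FG nG]]|nF] := pselect (exists G, F G /\ graph_on S0 f0 `<=` G).
    by right=> p /nG Gp; exists G.
  left; rewrite -subset0 => p [G FG Gp].
  have [_ [G0|G0]] := FP _ FG; first by rewrite -G0.
  by exfalso; apply: nF; exists G.
move=> G [[Gp G0] maxG].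
have sub0 : graph_on S0 f0 `<=` G.
  case: G0 => // G0; exfalso; apply: (maxG (graph_on S0 f0)).
    rewrite G0; split=> // /(_ ((k, k), f0 (k, k))); apply.
    by split=> //=; exists 0%N.
  by split; [exact: graph_on_pairing|right].
have [f [+ /seteqP[]]] := pairing_graphE k Gp.
set S := [set x | _] => fP subG Gsub.
have Si n : S (i n).
  by exists (f0 (i n, i n)); apply: sub0; split=> //=; exists n.
have [fS fI] := fP.
have ij m n : m != n -> i m <> i n by move=> /eqP mn /iinj.
have [[g [ginj gS]]|[g [ginj gS]]] := embeds_total S (~` S).
  have [F [FP FE]] := pairing_on_extend fP ginj gS (Si 0%N) (Si 1%N) (Si 2%N)
    (ij 0%N 1%N isT) (ij 0%N 2%N isT) (ij 1%N 2%N isT).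
  exfalso; apply: (maxG (graph_on (S `|` g @` S) F)).
    split.
      move=> [[x y] z] /subG[/= Sx Sy ->].
      by split=> /=; [left|left|rewrite FE].
    move=> /(_ ((g k, g k), F (g k, g k))) Gg.
    have [|/= + _ _] := subG _ (Gg _); last exact: (gS k (Si 0%N)).
    by split=> //=; right; exists k => //; exact: Si.
  split; first exact: graph_on_pairing.
  right=> -[[x y] z] /sub0/subG[/= Sx Sy ->].
  by split=> /=; [left|left|rewrite FE].
(* Pairing with the distinct tags [i 0] and [i 1] keeps the images of [S] and of its complement
   disjoint inside [S]. *)
pose h x := if `[< S x >] then f (i 0%N, x) else f (i 1%N, g x).
have hS x : S (h x).
  rewrite /h; case: ifPn => [/asboolP|/asboolPn]; first exact: fS.
  by move=> nSx; apply: (fS) => //; exact: gS.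
have hI : injective h.
  move=> x y; rewrite /h.
  case: ifPn => [/asboolP Sx|/asboolPn nSx];
    case: ifPn => [/asboolP Sy|/asboolPn nSy].
  - by move=> /(fI _ _ _ _ (Si _) Sx (Si _) Sy)[].
  - by move=> /(fI _ _ _ _ (Si _) Sx (Si _) (gS _ nSy))[/iinj].
  - by move=> /(fI _ _ _ _ (Si _) (gS _ nSx) (Si _) Sy)[/iinj].
  - move=> /(fI _ _ _ _ (Si _) (gS _ nSx) (Si _) (gS _ nSy))[_ /ginj].
    by apply; exact: mem_set.
exists (fun p => f (h p.1, h p.2)) => -[x y] [x' y'] /=.
by move=> /(fI _ _ _ _ (hS _) (hS _) (hS _) (hS _))[/hI -> /hI ->].
Qed.

(** The length is recorded because iterated pairing that ends in a fixed element need not separate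
    lists of different lengths. *)
Lemma seq_embedding (K : Type) :
  [set: nat] #<= [set: K] -> exists f : seq K -> K, injective f.
Proof.
move=> Koo; have [p pI] := infinite_pairing Koo.
have [i iI] := nat_card_leP Koo.
pose e := foldr (fun x y => p (x, y)) (i 0%N).
exists (fun s => p (i (size s), e s)) => s t /pI[] /iI.
elim: s t => [|x s IHs] [|y t] //= [st] /pI[-> est].
by rewrite (IHs t).
Qed.

(** The target indexes the final decomposition of [Y]. A surjection suffices because repeated pieces
    do no harm; it is a left inverse of an injective coding. *)
Lemma index_surjection (K : Type) : [set: nat] #<= [set: K] ->
  exists h : K -> K * seq (K * K) * nat * nat, forall x, exists k, h k = x.
Proof.
move=> Koo; have [p pI] := infinite_pairing Koo.
have [q qI] := seq_embedding Koo.
have [i iI] := nat_card_leP Koo.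
pose e (x : K * seq (K * K) * nat * nat) :=
  p (p (p (x.1.1.1, q (map p x.1.1.2)), i x.1.2), i x.2).
have eI : injective e.
  move=> [[[a s] m] n] [[[a' s'] m'] n'] /pI[/pI[/pI[-> /qI/(inj_map pI) ->]]].
  by move=> /iI -> /iI ->.
have /choice[h hP] : forall k, exists x, forall y, k = e y -> x = y.
  move=> k; have [[x ->]|nk] := pselect (exists x, k = e x).
    by exists x => y /eI.
  by exists (i 0%N, [::], 0%N, 0%N) => y kE; case: nk; exists y.
by exists h => x; exists (e x); exact: hP.
Qed.

(** * Covers of bounded order of compact sets *)

Lemma separating_function (R : realType) (Z : topologicalType) (a : Z)
    (B : set Z) : completely_regular_space Z -> closed B -> ~ B a ->
  exists f : Z -> R, [/\ continuous f, forall z, 0 <= f z <= 1, f a = 1 &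
    forall z, B z -> f z = 0].
Proof.
move=> crZ clB nBa.
have /(@uniform_separatorP _ R)[f [fc f01 fa fB]] := crZ _ _ clB nBa.
exists (fun z => 1 - f z); split.
- by move=> z; apply: cvgB; [exact: cvg_cst|exact: fc].
- move=> z; have := f01 (f z); rewrite /= in_itv /= => h.
  by have /andP[] := h (ex_intro2 _ _ z I erefl); lra.
- by rewrite (_ : f a = 0) ?subr0//; apply: fa; exists a.
- by move=> z Bz; rewrite (_ : f z = 1) ?subrr//; apply: fB; exists z.
Qed.

(** The filter of all sufficiently large finite sets, given by lists; compactness in its
    near-covering form along this filter produces finite subsets. *)
Definition supersets {T : eqType} : set_system (seq T) :=
  filter_from setT (fun s : seq T => [set t : seq T | {subset s <= t}]).

Lemma supersets_filter (T : eqType) : Filter (@supersets T).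
Proof.
apply: filter_from_filter; first by exists [::].
move=> s t _ _; exists (s ++ t) => // r sub; split=> x xs; apply: sub;
  by rewrite mem_cat xs ?orbT.
Qed.

Lemma compact_finite_subcover (Z : topologicalType) (A : set Z)
    (C : Z -> set Z) : compact A -> (forall x, A x -> nbhs x (C x)) ->
  exists s : seq Z, (forall x, x \in s -> A x) /\
    forall z, A z -> exists2 x, x \in s & C x z.
Proof.
move=> /compact_near_coveringP cA AC.
have := cA _ (@supersets Z)
  (fun s z => exists x, [/\ x \in s, A x & C x z]) (supersets_filter Z).
case=> [x Ax|s _ /(_ s) sA].
  exists (C x, [set t : seq Z | x \in t]) => /=.
    split; first exact: AC.
    by exists [:: x] => // t; apply; rewrite inE.
  by move=> [z t] /= [Cz xt]; exists x.
exists [seq x <- s | `[< A x >]]; split=> [x|z Az].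
  by rewrite mem_filter => /andP[/asboolP].
have [x [xs Ax Cx]] := sA (fun _ => id) _ Az; exists x => //.
by rewrite mem_filter xs andbT; apply/asboolP.
Qed.

Lemma open_positive (R : realType) (Z : topologicalType) (f : Z -> R) (r : R) :
  continuous f -> open [set z | r < f z].
Proof.
move=> fc; apply: (@open_comp Z R^o f [set t : R | r < t]) => [z _|].
  exact: fc.
exact: open_gt.
Qed.

Lemma closed_nonneg (R : realType) (Z : topologicalType) (f : Z -> R) (r : R) :
  continuous f -> closed [set z | r <= f z].
Proof.
move=> fc; apply: (@preimage_closed Z R^o f [set t : R | r <= t]) => [z _|].
  exact: fc.
exact: closed_ge.
Qed.

Lemma continuous_sum (R : realType) (Z : topologicalType) (I : Type)
    (s : seq I) (P : pred I) (F : I -> Z -> R) :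
  (forall i, P i -> continuous (F i)) ->
  continuous (fun z => \sum_(i <- s | P i) F i z).
Proof. by apply: (@continuous_big R^o); exact: add_continuous. Qed.

Definition cover_order (Z : Type) (J : finType) (V : J -> set Z) (z : Z) : nat :=
  #|[pred j | `[< V j z >]]|.

(* [A] has covering dimension less than [N], for covers of [A] by open sets
   of the ambient space. *)
Definition dim_lt (Z : topologicalType) (N : nat) (A : set Z) : Prop :=
  forall (I : Type) (U : I -> set Z),
  (forall i, open (U i)) -> A `<=` \bigcup_i U i ->
  exists (J : finType) (V : J -> set Z),
    [/\ forall j, open (V j), A `<=` \bigcup_j V j,
        forall j z, V j z -> exists i, V j `<=` U i &
        forall z, A z -> (cover_order V z <= N)%N].

Section shrinking.
Context (R : realType) (Z : topologicalType)
  (crZ : completely_regular_space Z).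

(** Complete regularity gives bumps inside the members of the cover. The lower bound 1 on [A] makes
    the sum of the bumps at least 1 there, so that [A] can later be cut off by a continuous
    function. *)
Lemma finite_bump_cover (A : set Z) (I : Type) (U : I -> set Z) :
  compact A -> (forall i, open (U i)) -> A `<=` \bigcup_i U i ->
  exists (s : seq Z) (g : Z -> Z -> R),
    [/\ forall x, continuous (g x), forall x z, 0 <= g x z,
        forall x, x \in s -> exists i, [set z | 0 < g x z] `<=` U i &
        forall z, A z -> exists2 x, x \in s & 1 <= g x z].
Proof.
move=> cA oU AU.
have /choice[g gP] : forall x, exists g : Z -> R, [/\ continuous g,
    forall z, 0 <= g z &
    A x -> g x = 2 /\ exists i, [set z | 0 < g z] `<=` U i].
  move=> x; have [Ax|nA] := pselect (A x); last first.
    by exists (fun=> 0); split=> // z; exact: cvg_cst.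
  have [i _ Uix] := AU _ Ax.
  have nUx : ~ (~` U i) x by move=> /(_ Uix).
  have [f [fc f01 fx f0]] :=
    separating_function R crZ (open_closedC (oU i)) nUx.
  (* The value 2 at the centre leaves room for the open condition [1 < g x z]. *)
  exists (fun z => 2 * f z); split.
  - by move=> z; apply: cvgM; [exact: cvg_cst|exact: fc].
  - by move=> z; have := f01 z; lra.
  - move=> _; split; first by rewrite fx mulr1.
    exists i => z /= fz; apply: contrapT => nU; move: fz.
    by rewrite f0// mulr0 ltxx.
have [x Ax|s [sA scov]] :=
    @compact_finite_subcover _ A (fun x => [set z | 1 < g x z]) cA _.
  have [gc _ /(_ Ax)[gx _]] := gP x.
  by apply: open_nbhs_nbhs; split; [exact: open_positive|rewrite /= gx; lra].
exists s, g; split=> [x|x|x xs|z Az]; try by have [] := gP x.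
- by have [_ _ /(_ (sA _ xs))[]] := gP x.
- by have [x xs /= /ltW] := scov _ Az; exists x.
Qed.

(** An unnormalised partition of unity: [u j] sums the bumps that live inside [W j], a bump being
    counted once for each such [j]. *)
Lemma bump_shrinking (A : set Z) (J : finType) (W : J -> set Z) :
  compact A -> (forall j, open (W j)) -> A `<=` \bigcup_j W j ->
  exists u : J -> Z -> R,
    [/\ forall j, continuous (u j), forall j z, 0 <= u j z,
        forall j z, 0 < u j z -> W j z &
        forall z, A z -> exists j, 0 < u j z].
Proof.
move=> cA oW AW; have [s [g [gc g0 gW gA]]] := finite_bump_cover cA oW AW.
exists (fun j z => \sum_(x <- s | `[< [set z | 0 < g x z] `<=` W j >]) g x z).
split=> [j|j z|j z|z Az].
- by apply: continuous_sum => x _; exact: gc.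
- exact: sumr_ge0.
- apply: contraPP => nW; apply/negP; rewrite -leNgt.
  rewrite big1// => x /asboolP gx; apply/eqP; rewrite -[_ == _]negbK.
  by apply/negP => gxz; apply/nW/gx; rewrite /= lt_def gxz g0.
- have [x xs gx] := gA _ Az; have [j gj] := gW _ xs; exists j.
  rewrite (big_rem x xs) /=; case: asboolP => // _.
  by apply: ltr_pwDl; [exact: lt_le_trans gx|exact: sumr_ge0].
Qed.

(* The set [O j] keeps the points at which [u j] is positive and among the [N]
   largest values of the family. *)
Lemma order_thickening (N : nat) (A : set Z) (J : finType) (W : J -> set Z) :
  compact A -> (forall j, open (W j)) -> A `<=` \bigcup_j W j ->
  (forall z, A z -> (cover_order W z <= N)%N) ->
  exists O : J -> set Z,
    [/\ forall j, open (O j), forall j, O j `<=` W j, A `<=` \bigcup_j O j &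
        forall z, (cover_order O z <= N)%N].
Proof.
move=> cA oW AW AN; have [u [uc u0 uW uA]] := bump_shrinking cA oW AW.
pose big j z := [pred k | u j z <= u k z].
exists (fun j => [set z | 0 < u j z /\ (#|big j z| <= N)%N]); split.
- move=> j.
  suff oB : open [set z | (#|big j z| <= N)%N].
    exact: (openI (open_positive 0 (uc j)) oB).
  (* The complement is a finite union of closed sets, one for each set [S] of more than [N] indices
     on which all values are at least [u j z]. *)
  have -> : [set z | (#|big j z| <= N)%N] = ~` \bigcup_(S in
      [set` [set S : {set J} | (N < #|S|)%N]%SET])
      \bigcap_(k in [set` S]) [set z | u j z <= u k z].
    apply/seteqP; split=> z /=.
      move=> le [S]; rewrite /= inE => NS Sz.
      have : (#|S| <= #|big j z|)%N.
        by apply/subset_leq_card/fintype.subsetP => k kS; rewrite inE; exact: Sz.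
      by rewrite leqNgt (leq_ltn_trans le).
    rewrite leqNgt => nS; apply/negP => lt; apply: nS.
    exists [set k in big j z]%SET => /=; first by rewrite inE cardsE.
    by move=> k /=; rewrite !inE.
  apply: closed_openC; apply: closed_bigcup; first exact: finite_finset.
  move=> S _; apply: closed_bigI => k _.
  have -> : [set z | u j z <= u k z] = [set z | 0 <= u k z - u j z].
    by apply/seteqP; split=> z /=; rewrite subr_ge0.
  by apply: closed_nonneg => z; apply: cvgB; exact: uc.
- by move=> j z [/uW].
- move=> z Az; have [j uj] := uA _ Az; exists j => //; split=> //.
  apply: leq_trans (AN _ Az); apply/subset_leq_card/fintype.subsetP => k.
  by rewrite !inE => uk; apply/asboolP/uW; exact: lt_le_trans uk.
- move=> z; rewrite leqNgt; apply/negP => lt.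
  have /card_gt0P[j0 j0P] := leq_ltn_trans (leq0n N) lt.
  (* If more than [N] members contained [z], the one with the least value would see all of them in
     [big j z]. *)
  have [j jP jmin] := @Order.TotalTheory.arg_minP _ _ _ _ _ (fun j => u j z) j0P.
  move: jP => /= /asboolP[_]; rewrite leqNgt => /negP; apply.
  apply: leq_trans lt _; apply/subset_leq_card/fintype.subsetP => k kP.
  by rewrite inE; exact: jmin.
Qed.

End shrinking.

(** The order is now bounded on all of [Z], so that covers of different compact sets can be put
    together. *)
Lemma dim_lt_thick (R : realType) (Z : topologicalType) (N : nat) (A : set Z) :
  completely_regular_space Z -> compact A -> dim_lt N A ->
  forall (I : Type) (U : I -> set Z),
  (forall i, open (U i)) -> A `<=` \bigcup_i U i ->
  exists (J : finType) (V : J -> set Z),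
    [/\ forall j, open (V j), A `<=` \bigcup_j V j,
        forall j z, V j z -> exists i, V j `<=` U i &
        forall z, (cover_order V z <= N)%N].
Proof.
move=> crZ cA dA I U oU AU; have [J [V [oV AV VU VN]]] := dA I U oU AU.
have [W [oW WV AW WN]] := order_thickening R crZ cA oV AV VN.
exists J, W; split=> // j z /WV /VU[i Vi]; exists i.
by move=> y /WV; exact: Vi.
Qed.

Definition sum_cover (Z : Type) (J1 J2 : finType) (V : J1 -> set Z)
    (W : J2 -> set Z) (j : J1 + J2) : set Z :=
  match j with inl j => V j | inr j => W j end.

Lemma sum_cover_order (Z : Type) (J1 J2 : finType) (V : J1 -> set Z)
    (W : J2 -> set Z) (z : Z) :
  cover_order (sum_cover V W) z = (cover_order V z + cover_order W z)%N.
Proof.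
rewrite /cover_order -!sum1_card big_sumType /=.
by congr (_ + _)%N; apply: eq_bigl => j.
Qed.

Lemma dim_lt_union (R : realType) (Z : topologicalType) (N1 N2 : nat)
    (A B : set Z) :
  completely_regular_space Z -> compact A -> compact B ->
  dim_lt N1 A -> dim_lt N2 B -> dim_lt (N1 + N2) (A `|` B).
Proof.
move=> crZ cA cB dA dB I U oU ABU.
have [|J1 [V [oV AV VU VN]]] := dim_lt_thick R crZ cA dA oU.
  by move=> z Az; apply: ABU; left.
have [|J2 [W [oW BW WU WN]]] := dim_lt_thick R crZ cB dB oU.
  by move=> z Bz; apply: ABU; right.
exists (J1 + J2)%type, (sum_cover V W); split.
- by case=> j; [exact: oV|exact: oW].
- by move=> z [/AV|/BW] [j _ Vj]; [exists (inl j)|exists (inr j)].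
- by move=> [j|j] z /=; [exact: VU|exact: WU].
- by move=> z _; rewrite sum_cover_order; exact: leq_add.
Qed.

(** A cover of [B] by open sets of [Z] covers a neighbourhood of [B]. What it leaves of [A] is
    compact and disjoint from [B], hence has its own cover, and the two orders add. *)
Lemma dim_lt_glue (R : realType) (Z : topologicalType) (N1 N2 : nat)
    (A B : set Z) :
  completely_regular_space Z -> compact A -> compact B -> B `<=` A ->
  dim_lt N1 B -> (forall C, compact C -> C `<=` A `\` B -> dim_lt N2 C) ->
  dim_lt (N1 + N2) A.
Proof.
move=> crZ cA cB BA dB dC I U oU AU.
have [|J1 [V [oV BV VU VN]]] := dim_lt_thick R crZ cB dB oU.
  by move=> z /BA /AU.
pose C := A `&` ~` \bigcup_j V j.
have cC : compact C.
  by apply: compact_closedI => //; apply/open_closedC/bigcup_open.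
have CAB : C `<=` A `\` B by move=> z [Az nV]; split=> // /BV.
have [|J2 [W [oW CW WU WN]]] := dim_lt_thick R crZ cC (dC _ cC CAB) oU.
  by move=> z [/AU].
exists (J1 + J2)%type, (sum_cover V W); split.
- by case=> j; [exact: oV|exact: oW].
- move=> z Az; have [[j _ Vj]|nV] := pselect ((\bigcup_j V j) z).
    by exists (inl j).
  by have [//|j _ Wj] := CW z; exists (inr j).
- by move=> [j|j] z /=; [exact: VU|exact: WU].
- by move=> z _; rewrite sum_cover_order; exact: leq_add.
Qed.

Lemma finType_card_le (J : finType) (P : pred J) (n : nat) :
  [set j | P j] #<= `I_n <-> (#|P| <= n)%N.
Proof.
have PE : [set j | P j] #= `I_#|P|.
  have -> : [set j | P j] = [set` [fset j in enum P]%fset].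
    by apply/seteqP; split=> j /=; rewrite !inE mem_enum.
  apply/card_eq_fsetP; rewrite card_fseq undup_id ?enum_uniq//.
  by rewrite -cardE.
by rewrite (card_le_eql PE) card_le_II.
Qed.

Lemma open_set_typeE (Z : topologicalType) (F : set Z) (V : set (set_type F)) :
  open V -> exists2 W, open W & V = set_val @^-1` W.
Proof. by case=> W oW <-; exists W. Qed.

Lemma functionally_open_open (R : realType) (Z : topologicalType) (V : set Z) :
  functionally_open R V -> open V.
Proof.
move=> [f fc ->]; have -> : [set x | f x != 0] = [set x | 0 < `|f x|].
  by apply/seteqP; split=> x /=; rewrite normr_gt0.
by apply: open_positive => z; apply: cvg_norm; exact: fc.
Qed.

(** Bumps turn an open cover of [A] into cozero sets of [F]; one more cozero set, disjoint from [A],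
    completes them to a cover of [F]. *)
Lemma dim_le_dim_lt (R : realType) (Z : topologicalType) (n : nat)
    (F A : set Z) :
  completely_regular_space Z -> compact A -> A `<=` F ->
  dim_le R n (set_type F) -> dim_lt n.+1 A.
Proof.
move=> crZ cA AF dF I U oU AU.
have [s [g [gc g0 gU gA]]] := finite_bump_cover R crZ cA oU AU.
(* [h] is twice the positive part of [S]: it vanishes on [A], where the bumps sum to at least 1, and
   equals 2 where all bumps vanish. *)
pose S z := 1 - \sum_(x <- s) g x z; pose h z := S z + `|S z|.
have Sc : continuous S.
  move=> z; apply: cvgB; first exact: cvg_cst.
  by apply: continuous_sum => x _; exact: gc.
have hc : continuous h by move=> z; apply: cvgD; [|apply: cvg_norm]; exact: Sc.
have val_continuous : continuous (set_val : set_type F -> Z).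
  exact: initial_continuous.
have cozval (f : Z -> R) : continuous f ->
    functionally_open R [set p : set_type F | f (set_val p) != 0].
  move=> fc; exists (f \o set_val) => // p.
  by apply: continuous_comp; [exact: val_continuous|exact: fc].
have hA z : A z -> h z = 0.
  move=> /gA[x xs gx]; suff : S z <= 0 by move=> S0; rewrite /h ler0_norm// subrr.
  rewrite subr_le0 (big_rem x xs) /=; apply: le_trans gx _.
  by rewrite lerDl sumr_ge0.
pose coz x := [set p : set_type F | g x (set_val p) != 0].
pose hz := [set p : set_type F | h (set_val p) != 0].
have [|D [[Dfin Dcoz Dcov] Dref Dord]] :=
    dF ((coz @` [set` s]) `|` [set hz]).
  split.
  - by rewrite finite_setU; split; [apply/finite_image/finite_seq|].
  - by move=> V [[x xs <-]|->]; exact: cozval.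
  - apply/seteqP; split=> // p _.
    have [[x xs gx]|ng] := pselect (exists2 x, x \in s & g x (set_val p) != 0).
      by exists (coz x) => //; left; exists x.
    exists hz; first by right.
    rewrite /hz /= /h /S big1_seq ?subr0 ?normr1 ?gt_eqF// => x /= xs.
    by apply/eqP; apply: contrapT => /negP gx; apply: ng; exists x.
(* Members of [D] are extended to open sets of [Z] and cut down by some [U i]; those inside [hz]
   miss [A] and become empty. *)
have /choice[ext extP] : forall V, exists V' : set Z, D V -> [/\ open V',
    forall z, V' z -> exists i, V' `<=` U i &
    forall p, A (set_val p) -> V p <-> V' (set_val p)].
  move=> V; have [DV|nD] := pselect (D V); last by exists set0.
  have [B oB VE] := open_set_typeE (functionally_open_open (Dcoz _ DV)).
  have [W [[x /= xs <-]|->] VW] := Dref _ DV.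
    have [i gi] := gU _ xs; exists (B `&` U i) => _; split.
    - exact: openI.
    - by move=> z _; exists i => y [].
    - move=> p Ap; rewrite VE; split=> [Bp|[]//]; split=> //; apply: gi => /=.
      by rewrite lt_def g0 andbT; apply: VW; rewrite VE.
  exists set0 => _; split=> [|z []|p Ap]; first exact: open0.
  by split=> // /VW; rewrite /hz /= hA// eqxx.
have /finite_fsetP[X DX] := Dfin.
have XD (j : X) : D (val j) by rewrite DX /=; exact: valP.
exists X, (fun j => ext (val j)); split=> [j|z Az|j z|z Az].
- by have [] := extP _ (XD j).
- pose p : set_type F := SigSub (mem_set (AF _ Az)).
  have [V DV Vp] : (\bigcup_(W in D) W) p by rewrite Dcov.
  have VX : V \in X by move: DV; rewrite DX.
  exists [` VX]%fset => //=.
  by have [_ _ /(_ p Az)[+ _]] := extP _ DV; exact.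
- by have [_ + _] := extP _ (XD j); exact.
- pose p : set_type F := SigSub (mem_set (AF _ Az)).
  apply/finType_card_le; apply: card_le_trans (Dord p).
  have inj_val : {in [set j : X | `[< ext (val j) z >]] &,
      injective (val : X -> set (set_type F))} by move=> ? ? _ _; exact: val_inj.
  rewrite -(card_le_eql (inj_card_eq inj_val)).
  apply: subset_card_le => V [j /= /asboolP zj <-]; split; first exact: XD.
  by have [_ _ /(_ p Az)[_]] := extP _ (XD j); exact.
Qed.

(** Extend the members of [C] to open sets of [Z], refine them on [A], and shrink the refinement to
    cozero sets, which does not raise the order. *)
Lemma dim_lt_dim_le (R : realType) (Z : topologicalType) (n : nat)
    (A : set Z) :
  completely_regular_space Z -> compact A ->
  dim_lt n.+1 A -> dim_le R n (set_type A).
Proof.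
move=> crZ cA dA C [Cfin Ccoz Ccov].
(* Sets outside [C] get the empty extension, so a point of [ext V] certifies [C V]. *)
have /choice[ext extP] : forall V, exists V' : set Z, [/\ open V',
    forall z, V' z -> C V & C V -> V = set_val @^-1` V'].
  move=> V; have [CV|nC] := pselect (C V); last first.
    by exists set0; split=> //; exact: open0.
  by have [B oB VE] := open_set_typeE (functionally_open_open (Ccoz _ CV));
    exists B.
have [V|z Az|J [V [oV AV VC Vn]]] := dA _ ext.
- by have [] := extP V.
- pose p : set_type A := SigSub (mem_set Az).
  have [V CV Vp] : (\bigcup_(W in C) W) p by rewrite Ccov.
  have [_ _ /(_ CV) VE] := extP V.
  by exists V => //; have := Vp; rewrite {1}VE.
have [u [uc u0 uV uA]] := bump_shrinking R crZ cA oV AV.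
pose coz j := [set p : set_type A | u j (set_val p) != 0].
have uP j p : coz j p -> V j (set_val p).
  by move=> /= ujp; apply: uV; rewrite lt_def ujp u0.
(* Only nonempty traces are kept: a point of the trace is needed to find a member of [C] that
   contains it. *)
exists [set W | exists j p, coz j p /\ W = coz j]; split.
- split.
  + apply: (@sub_finite_set _ _ (range coz)); last first.
      by apply: finite_image; exact: finite_finset.
    by move=> _ [j [p [_ ->]]]; exists j.
  + move=> _ [j [p [_ ->]]]; exists (u j \o set_val) => // q.
    by apply: continuous_comp; [exact: initial_continuous|exact: uc].
  + apply/seteqP; split=> // p _.
    have [|j uj] := uA (set_val p); first exact/set_mem/(valP p).
    have cjp : coz j p by rewrite /coz /= gt_eqF.
    by exists (coz j) => //; exists j, p.
- move=> _ [j [p [cjp ->]]]; have [W VW] := VC _ _ (uP _ _ cjp).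
  have [_ /(_ _ (VW _ (uP _ _ cjp))) CW /(_ CW) WE] := extP W.
  by exists W => // q /uP/VW; rewrite {2}WE.
- move=> p; have Ap : A (set_val p) by exact/set_mem/(valP p).
  apply: (@card_le_trans _ _ _ [set j | `[< V j (set_val p) >]]); last first.
    exact/finType_card_le/Vn.
  apply: card_le_trans (card_image_le coz _).
  apply: subset_card_le => _ [[j [q [_ ->]]] /= cjp].
  by exists j => //=; apply/asboolP/uP.
Qed.

(** * Finite supports *)

Lemma Cp_continuous (R : realType) (X : topologicalType) (f : Cp R X) :
  continuous (f : X -> R).
Proof. exact: (@cts_fun _ _ f). Qed.

Lemma Cp_scaleE (R : realType) (X : topologicalType) (a : R) (f : Cp R X)
    (x : X) : (a *: f) x = a * f x.
Proof. by []. Qed.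

Lemma Cp_subE (R : realType) (X : topologicalType) (f g : Cp R X) (x : X) :
  (f - g) x = f x - g x.
Proof. by []. Qed.

Lemma Cp_sum (R : realType) (X : topologicalType) (I : Type) (s : seq I)
    (P : pred I) (F : I -> Cp R X) (x : X) :
  (\sum_(i <- s | P i) F i) x = \sum_(i <- s | P i) F i x.
Proof. exact: (big_morph (fun f : Cp R X => f x)). Qed.

Definition Cp_square (R : realType) (X : topologicalType) (f : Cp R X) :
  Cp R X := mkcts (fun x => cvgM (@Cp_continuous _ _ f x) (@Cp_continuous _ _ f x)).

Lemma evaluation_continuous (R : realType) (X : topologicalType) (x : X) :
  continuous (fun f : Cp R X => f x).
Proof.
have coe : continuous ((fun f => f : X -> R) : Cp R X -> {ptws X -> R}).
  exact: initial_continuous.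
move=> f; apply: (@continuous_comp (Cp R X) {ptws X -> R} R _ (fun g => g x)).
  exact: coe.
exact: (@proj_continuous X (fun=> R) x).
Qed.

(** [e x] is the positive part of the bump at [x] minus the bumps at the other points. Two of these
    cannot be positive at one point, as each original bump would exceed the other there. *)
Lemma disjoint_bumps (R : realType) (X : topologicalType) (s : seq X)
    (O : X -> set X) :
  tychonoff_space X -> (forall x, x \in s -> open (O x) /\ O x x) ->
  exists e : X -> Cp R X, [/\ forall x, x \in s -> e x x = 1,
    forall x z, 0 <= e x z <= 1,
    forall x z, x \in s -> e x z != 0 -> O x z &
    forall x y z, x \in s -> y \in s -> e x z != 0 -> e y z != 0 -> x = y].
Proof.
move=> [crX hX] sO.
have fin_closed := (accessible_finite_set_closed.1 (hausdorff_accessible hX)).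
have /choice[h hP] : forall x, exists h : X -> R, [/\ continuous h,
    forall z, 0 <= h z <= 1, x \in s -> h x = 1,
    forall y, y \in s -> x != y -> h y = 0 &
    forall z, x \in s -> ~ O x z -> h z = 0].
  move=> x; have [xs|xs] := boolP (x \in s); last first.
    by exists (fun=> 0); split=> // [z|z]; [exact: cvg_cst|rewrite lexx ler01].
  have [oO Ox] := sO _ xs.
  pose B := ~` O x `|` [set` [seq y <- s | x != y]].
  have clB : closed B.
    by apply: closedU; [exact: open_closedC|exact: fin_closed].
  have nBx : ~ B x by case=> [/(_ Ox)//|/=]; rewrite mem_filter eqxx.
  have [f [fc f01 fx fB]] := separating_function R crX clB nBx.
  exists f; split=> // [y ys xy|z _ nO].
    by apply: fB; right; rewrite /= mem_filter xy.
  by apply: fB; left.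
pose d x z := h x z - \sum_(y <- undup s | x != y) h y z.
have hc x : continuous (h x) by have [] := hP x.
have dc x : continuous (d x).
  move=> z; apply: cvgB; first exact: hc.
  by apply: continuous_sum => y _; exact: hc.
pose e x z := (d x z + `|d x z|) / 2.
have ec x : continuous (e x).
  move=> z; apply: cvgM; last exact: cvg_cst.
  by apply: cvgD; [|apply: cvg_norm]; exact: dc.
have h0 x z : 0 <= h x z by have [_ /(_ z)/andP[]] := hP x.
have dh x z : d x z <= h x z by rewrite lerBlDr lerDl sumr_ge0.
have e_pos x z : e x z != 0 -> 0 < d x z.
  move=> exz; rewrite ltNge; apply: contraNN exz => d0.
  by rewrite /e ler0_norm// subrr mul0r.
exists (fun x => mkcts (ec x)); split=> /=.
- move=> x xs; have dx : d x x = 1.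
    rewrite /d big1_seq ?subr0; first by have [_ _ ->] := hP x.
    by move=> y /andP[]; rewrite mem_undup eq_sym => yx ys;
      have [_ _ _ /(_ x xs yx)] := hP y.
  by rewrite /mkcts /e dx normr1; lra.
- move=> x z; rewrite /mkcts /e; have := dh x z.
  have [_ /(_ z) + _ _ _] := hP x.
  move=> /andP[hz0 hz1] dhz; have [d0|d0] := lerP 0 (d x z).
    by rewrite ger0_norm//; apply/andP; split; lra.
  by rewrite ltr0_norm//; apply/andP; split; lra.
- move=> x z xs /e_pos dxz; apply: contrapT => nO.
  by have [_ _ _ _ /(_ z xs nO) hz] := hP x; have := dh x z; rewrite hz; lra.
- move=> x y z xs ys /e_pos dx /e_pos dy; apply/eqP; apply: contrapT => /negP xy.
  have le u v : u \in s -> v \in s -> u != v -> 0 < d u z -> h v z < h u z.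
    move=> us vs uv; rewrite /d subr_gt0; apply: le_lt_trans.
    by rewrite (big_rem v) ?mem_undup//= uv lerDl sumr_ge0.
  have := le _ _ xs ys xy dx; have := le _ _ ys xs _ dy.
  by rewrite eq_sym => /(_ xy); lra.
Qed.

(** Functions vanishing on larger and larger finite sets tend to 0 pointwise, so some finite set
    forces [|T f y| < 1]; rescaling [f] turns this into [T f y = 0]. *)
Lemma finite_determination (R : realType) (X Y : topologicalType)
    (T : {linear Cp R X -> Cp R Y}) (y : Y) : continuous T ->
  exists s : seq X, forall f : Cp R X, (forall x, x \in s -> f x = 0) -> T f y = 0.
Proof.
move=> Tc.
pose F : set_system (Cp R X) := filter_from setT
  (fun s : seq X => [set f : Cp R X | forall x, x \in s -> f x = 0]).
have FF : Filter F.
  apply: filter_from_filter; first by exists [::].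
  move=> s t _ _; exists (s ++ t) => // f fst; split=> x xs; apply: fst;
    by rewrite mem_cat xs ?orbT.
have F0 : F --> (0 : Cp R X).
  move=> A; rewrite nbhsE => -[_ [[B oB <-] B0] BA].
  apply: filterS BA _.
  have : ((fun f => f : X -> R) : Cp R X -> {ptws X -> R}) @ F -->
      (((0 : Cp R X) : X -> R) : {ptws X -> R}).
    apply/pointwise_cvgP => x V V0.
    exists [:: x] => // f /(_ x); rewrite inE => /(_ (eqxx _)) fx.
    by rewrite /= fx; exact: nbhs_singleton.
  by apply; exact: open_nbhs_nbhs.
have TF : (fun f => T f y) @ F --> (0 : R).
  have -> : 0 = T 0 y by rewrite raddf0.
  apply: (@cvg_comp _ _ _ T (fun g : Cp R Y => g y) _ (nbhs (T 0))).
    by move=> A /Tc TA; exact: (F0 _ TA).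
  exact: evaluation_continuous.
have [|s _ sT] := TF [set t : R | `|t| < 1].
  by exists 1 => //= t; rewrite /= sub0r normrN.
exists s => f fs; apply/eqP; rewrite -normr_eq0; apply/eqP.
have [//|Tf] := eqVneq (`|T f y|) 0.
have := sT ((T f y)^-1 *: f); rewrite /= linearZ.
have -> : ((T f y)^-1 *: T f) y = 1.
  by rewrite /= /Cp_scale /mkcts mulVf// -normr_eq0.
rewrite normr1 ltxx => H; exfalso; apply/notF/H => x xs.
by rewrite Cp_scaleE fs// mulr0.
Qed.

(** Since [T f y] depends only on the values of [f] on [s0], [f] may be replaced by its
    interpolation by bumps. Points with coefficient 0 are dropped, which leaves the true support. *)
Lemma functional_support (R : realType) (X Y : topologicalType)
    (T : {linear Cp R X -> Cp R Y}) (y : Y) :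
  tychonoff_space X -> continuous T ->
  exists (s : seq X) (l : X -> R), [/\ uniq s, forall x, x \in s -> l x != 0 &
    forall f, T f y = \sum_(x <- s) l x * f x].
Proof.
move=> tX /(finite_determination y)[s0 s0P].
have [|e [e1 _ _ edisj]] := @disjoint_bumps R X (undup s0) (fun=> setT) tX.
  by move=> x _; split=> //; exact: openT.
pose l x := T (e x) y.
exists [seq x <- undup s0 | l x != 0], l; split.
- by rewrite filter_uniq ?undup_uniq.
- by move=> x; rewrite mem_filter => /andP[].
- move=> f; rewrite big_filter.
  pose g := \sum_(x <- undup s0) f x *: e x.
  have : T (f - g) y = 0.
    apply: s0P => x; rewrite -mem_undup => xs.
    rewrite Cp_subE /g Cp_sum (bigD1_seq x) ?undup_uniq//= big1_seq ?addr0.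
      by rewrite Cp_scaleE e1// mulr1 subrr.
    move=> z /andP[zx zs]; rewrite Cp_scaleE.
    have [->|ez] := eqVneq (e z x) 0; first by rewrite mulr0.
    by move: zx; rewrite (edisj _ _ x zs xs ez) ?eqxx// e1// oner_neq0.
  rewrite linearB /= => /eqP.
  rewrite Cp_subE subr_eq0 => /eqP ->.
  rewrite /g linear_sum Cp_sum [RHS]big_mkcond /=.
  apply: eq_bigr => x _; rewrite linearZ Cp_scaleE.
  rewrite -/(l x); have [->|lx] := eqVneq (l x) 0; first by rewrite mulr0.
  by rewrite mulrC.
Qed.

(** The condition [g y - g z > 0] defines a nonempty open set of [g], which the dense range
    meets. *)
Lemma dense_range_separates (R : realType) (X Y : topologicalType)
    (T : {linear Cp R X -> Cp R Y}) (y z : Y) :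
  tychonoff_space Y -> dense (range T) -> y <> z ->
  exists f, T f y <> T f z.
Proof.
move=> [crY hY] dT yz.
have clz : closed [set z] by apply/accessible_closed_set1/hausdorff_accessible.
have [h [hc h01 hy hz]] := separating_function R crY clz yz.
pose D (g : Cp R Y) := g y - g z.
have Dc : continuous D.
  move=> g; exact: (cvgB (@evaluation_continuous R Y y g)
    (@evaluation_continuous R Y z g)).
have [||g [/= Dg [f _ fg]]] := dT [set g : Cp R Y | 0 < D g].
- exists (mkcts hc : Cp R Y); suff : 0 < h y - h z by [].
  by rewrite hy (hz z)// subr0.
- exact: open_positive.
- by exists f; rewrite fg => e; move: Dg; rewrite /D e subrr ltxx.
Qed.

(** * Fine covers with controlled order *)

Lemma near_seq (I : eqType) (Z : Type) (F : set_system Z) (s : seq I)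
    (P : I -> Z -> Prop) : Filter F ->
  (forall i, i \in s -> \forall z \near F, P i z) ->
  \forall z \near F, forall i, i \in s -> P i z.
Proof.
move=> FF; elim: s => [|a s IHs] sP; first by apply: filterE => z i.
have := IHs (fun i is_ => sP i (mem_behead (s := a :: s) is_)).
apply: filterS2 (sP a (mem_head _ _)) => z Pa Ps i.
by rewrite inE => /predU1P[->|/Ps].
Qed.

Lemma near_neq0 (R : realType) (Z : topologicalType) (f : Z -> R) (z : Z) :
  continuous f -> f z != 0 -> \forall t \near z, f t != 0.
Proof.
move=> fc fz; apply: open_nbhs_nbhs; split=> //.
by apply: (functionally_open_open (R := R)); exists f.
Qed.

Lemma near_close (R : realType) (Z : topologicalType) (f : Z -> R) (z : Z)
    (e : R) : continuous f -> 0 < e -> \forall t \near z, `|f z - f t| < e.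
Proof. by move=> fc e0; have /(@cvgrPdist_lt _ R^o)/(_ e e0) := fc z. Qed.

Lemma near_close_seq (R : realType) (X : topologicalType) (L : seq (Cp R X))
    (x : X) (e : R) : 0 < e ->
  \forall t \near x, forall f : Cp R X, f \in L -> `|f x - f t| < e.
Proof.
move=> e0; apply: near_seq => f _; apply: near_close => //.
exact: Cp_continuous.
Qed.

Lemma compact_seq_bounded (R : realType) (X : topologicalType) (F : set X)
    (L : seq (Cp R X)) : compact F ->
  exists M : R, 0 <= M /\
    forall (f : Cp R X) x, f \in L -> F x -> `|f x| <= M.
Proof.
move=> cF; have [x _|s [_ sF]] := @compact_finite_subcover _ F
  (fun x => [set t | forall f : Cp R X, f \in L -> `|f x - f t| < 1]) cF _.
  exact: near_close_seq.
pose N := \sum_(x <- s) \sum_(f <- L) `|(f : Cp R X) x|.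
exists (1 + N); split.
  by rewrite addr_ge0// sumr_ge0// => x _; exact: sumr_ge0.
move=> f x fL /sF[y ys yx].
have le1 : `|f x| <= 1 + `|f y|.
  have := ler_normB (f y) (f y - f x); rewrite opprB addrC subrK.
  by have := yx f fL => /=; lra.
apply: le_trans le1 _; rewrite lerD2l /N (big_rem y ys) /= (big_rem f fL) /=.
rewrite -addrA lerDl addr_ge0 ?sumr_ge0// => z _; exact: sumr_ge0.
Qed.

(** What matters is uniformity: the bound [n] comes from [F] alone, however long [L] and however
    small [e]. *)
Lemma small_oscillation_cover (R : realType) (X : topologicalType) (n : nat)
    (F : set X) (L : seq (Cp R X)) (e : R) : 0 < e -> dim_lt n F ->
  exists (J : finType) (V : J -> set X),
    [/\ forall j, open (V j), F `<=` \bigcup_j V j,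
        forall j x y (f : Cp R X), V j x -> V j y -> f \in L ->
          `|f x - f y| < e &
        forall x, F x -> (cover_order V x <= n)%N].
Proof.
move=> e0 dF; pose U x :=
  interior [set t | forall f : Cp R X, f \in L -> `|f x - f t| < e / 2].
have [x|x Fx|J [V [oV FV VU Vn]]] := dF _ U.
- exact: open_interior.
- by exists x => //; apply: near_close_seq; lra.
exists J, V; split=> // j x y f Vx Vy fL.
have [z VUz] := VU _ _ Vx.
have := nbhs_singleton (VUz _ Vx) _ fL; have := nbhs_singleton (VUz _ Vy) _ fL.
have := ler_normD (f x - f z) (f z - f y); rewrite addrA subrK.
by rewrite (distrC (f x) (f z)); lra.
Qed.

(** Open intervals of radius [h = e / 2] about the points [- r + k * h]; a real number lies in at
    most two of them. *)
Lemma interval_cover (R : realType) (r e : R) : 0 < e ->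
  exists (J : finType) (V : J -> set R),
    [/\ forall j, open (V j), [set t | `|t| <= r] `<=` \bigcup_j V j,
        forall j s t, V j s -> V j t -> `|s - t| < e &
        forall t, (cover_order V t <= 2)%N].
Proof.
move=> e0; pose h := e / 2; have h0 : 0 < h by rewrite /h; lra.
(* For [|t| <= r] the number [(t + r) / h] is at most [2 * r / h], so its integer part is an
   index. *)
pose K := (Num.truncn (2 * r / h)).+1.
pose V (k : 'I_K) := [set t : R | `|(t + r) / h - k%:R| < 1].
exists 'I_K, V; split.
- move=> k; have -> : V k = [set t | - 1 < - `|(t + r) / h - k%:R|].
    by apply/seteqP; split=> t; rewrite /V /= ltrN2.
  apply: open_positive => t; apply: cvgN; apply: cvg_norm; apply: cvgB.
    by apply: cvgM; [apply: cvgD; [exact: cvg_id|exact: cvg_cst]|exact: cvg_cst].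
  exact: cvg_cst.
- move=> t /=; rewrite ler_norml => /andP[t1 t2].
  have s0 : 0 <= (t + r) / h by rewrite divr_ge0 ?(ltW h0)//; lra.
  have lt : (Num.truncn ((t + r) / h) < K)%N.
    rewrite /K ltnS; apply: Num.Theory.le_truncn.
    by rewrite ler_pM2r ?invr_gt0//; lra.
  exists (Ordinal lt) => //; rewrite /V /= ger0_norm.
    have /andP[_] := Num.Theory.truncn_itv s0.
    by rewrite -natr1; lra.
  by have /andP[] := Num.Theory.truncn_itv s0; lra.
- move=> k s t; rewrite /V /= !ltr_norml => /andP[s1 s2] /andP[t1 t2].
  have -> : s - t = ((s + r) / h - (t + r) / h) * h.
    by rewrite mulrBl !mulfVK ?gt_eqF//; ring.
  apply/andP; split.
    by have : e = 2 * h; [rewrite /h; lra|move=> ->; nra].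
  by have : e = 2 * h; [rewrite /h; lra|move=> ->; nra].
- move=> t; pose s := (t + r) / h; pose k0 := Num.truncn s.
  rewrite /cover_order cardE -(size_map (@nat_of_ord K)).
  apply: (@uniq_leq_size _ _ [:: k0; k0.+1]).
    by rewrite map_inj_uniq ?enum_uniq//; exact: val_inj.
  move=> _ /mapP[k + ->]; rewrite mem_enum inE => /asboolP.
  rewrite /V /= -/s ltr_norml => /andP[k1 k2].
  rewrite !inE; have [s0|s0] := leP 0 s.
    have /andP[k3 k4] := Num.Theory.truncn_itv s0; rewrite -/k0 in k3 k4.
    have : (k0 < k.+1)%N by rewrite -(ltr_nat R) -natr1; lra.
    have : (k < k0.+2)%N.
      by rewrite -(ltr_nat R); move: k4; rewrite -!natr1; lra.
    by lia.
  have -> : k0 = 0%N.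
    by apply/eqP; rewrite -leqn0 leqNgt Num.Theory.truncn_gt0 -ltNge; lra.
  suff : (k < 1)%N by lia.
  by rewrite -(ltr_nat R); lra.
Qed.

(** It is enough to have members open relative to [C] that refine the cover inside [C]: replace
    [W j] by the interior of its union with the complement of [C], cut down by some [U i]. *)
Lemma dim_lt_relative (Z : topologicalType) (N : nat)
    (C : set Z) :
  (forall (I : Type) (U : I -> set Z),
    (forall i, open (U i)) -> C `<=` \bigcup_i U i ->
    exists (J : finType) (W : J -> set Z),
      [/\ forall j y, C y -> W j y -> \forall z \near y, C z -> W j z,
          C `<=` \bigcup_j W j,
          forall j y, C y -> W j y ->
            exists i, forall z, C z -> W j z -> U i z &
          forall y, C y -> (cover_order W y <= N)%N]) ->
  dim_lt N C.
Proof.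
move=> H I U oU CU; have [J [W [Wnear CW WU WN]]] := H I U oU CU.
have /choice[U' U'P] : forall j, exists V : set Z, [/\ open V,
    forall z, V z -> exists i, V `<=` U i & forall z, C z -> W j z -> V z].
  move=> j; have [[y [Cy Wy]]|nW] := pselect (exists y, C y /\ W j y).
    have [i WUi] := WU _ _ Cy Wy; exists (U i); split=> // z _.
    by exists i.
  exists set0; split=> // [|z Cz Wz]; first exact: open0.
  by apply: nW; exists z.
exists J, (fun j => interior [set z | C z -> W j z] `&` U' j); split.
- by move=> j; apply: openI; [exact: open_interior|have [] := U'P j].
- move=> z Cz; have [j _ Wj] := CW _ Cz; exists j => //; split.
    exact: Wnear.
  by have [_ _] := U'P j; exact.
- move=> j z [_ U'z]; have [_ /(_ _ U'z)[i U'i] _] := U'P j.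
  by exists i => y [_ /U'i].
- move=> z Cz; apply: leq_trans (WN _ Cz).
  apply/subset_leq_card/fintype.subsetP => j; rewrite !inE => /asboolP[Wz _].
  by apply/asboolP; exact: (nbhs_singleton Wz).
Qed.

(** * Strata of points with supports of a given size *)

Section strata.
Context (R : realType) (X Y : topologicalType) (T : Cp R X -> Y -> R)
  (supp : Y -> seq X) (lam : Y -> X -> R).
Context (tX : tychonoff_space X)
  (T_continuous : forall f, continuous (T f))
  (supp_uniq : forall y, uniq (supp y))
  (lam_neq0 : forall y x, x \in supp y -> lam y x != 0)
  (T_supp : forall y f, T f y = \sum_(x <- supp y) lam y x * f x)
  (T_separates : forall y z, y <> z -> exists f, T f y <> T f z).

Lemma T_single y x (f : Cp R X) : x \in supp y ->
  (forall z, z \in supp y -> z != x -> f z = 0) -> T f y = lam y x * f x.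
Proof.
move=> xy f0; rewrite T_supp (bigD1_seq x)//= big1_seq ?addr0// => z.
by move=> /andP[zx zy]; rewrite f0// mulr0.
Qed.

Lemma T_neq0 y (f : Cp R X) : T f y != 0 -> exists2 x, x \in supp y & f x != 0.
Proof.
move=> Tf; apply: contrapT => nx; move/eqP: Tf; apply.
rewrite T_supp big1_seq// => x /= xy.
suff -> : f x = 0 by rewrite mulr0.
by apply: contrapT => /eqP fx; apply: nx; exists x.
Qed.

Lemma T_scale a f y : T (a *: f) y = a * T f y.
Proof.
rewrite !T_supp mulr_sumr; apply: eq_bigr => x _.
by rewrite Cp_scaleE mulrCA.
Qed.

(** Each bump vanishes at the other support points, so applying [T] to it reads off one
    coefficient. *)
Lemma supp_bumps y (O : X -> set X) :
  (forall x, x \in supp y -> open (O x) /\ O x x) ->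
  exists e : X -> Cp R X, [/\ forall x, x \in supp y -> e x x = 1,
    forall x z, 0 <= e x z <= 1,
    forall x z, x \in supp y -> e x z != 0 -> O x z,
    forall x z t, x \in supp y -> z \in supp y -> e x t != 0 -> e z t != 0 ->
      x = z &
    forall x, x \in supp y -> T (e x) y = lam y x].
Proof.
move=> /(disjoint_bumps R tX)[e [e1 e01 eO eI]]; exists e; split=> // x xy.
rewrite (T_single xy) ?e1 ?mulr1// => z zy zx; apply/eqP.
apply: contraNT zx => exz; apply/eqP; apply: (eI _ _ z) => //.
by rewrite e1// oner_neq0.
Qed.

Lemma bump_matching (s t : seq X) (e : X -> Cp R X) : uniq s ->
  (forall x z u, x \in s -> z \in s -> e x u != 0 -> e z u != 0 -> x = z) ->
  (forall x, x \in s -> exists2 z, z \in t & e x z != 0) ->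
  exists p : X -> X, [/\ forall x, x \in s -> p x \in t,
    forall x, x \in s -> e x (p x) != 0 & {in s &, injective p}].
Proof.
move=> us eI et.
have /choice[p pP] : forall x, exists z, x \in s -> z \in t /\ e x z != 0.
  move=> x; have [/et[z]|] := boolP (x \in s); first by exists z.
  by exists x.
exists p; split=> [x /pP[]//|x /pP[]//|x z xs zs pxz].
have [_ ex] := pP _ xs; have [_ ez] := pP _ zs.
by apply: (eI _ _ (p x)) => //; rewrite pxz.
Qed.

(** The support size is lower semicontinuous: disjoint bumps at the points of [supp y] keep nonzero
    images near [y], and each then contains a support point of the nearby point. *)
Lemma supp_size_closed m : closed [set y | (size (supp y) <= m)%N].
Proof.
have -> : [set y | (size (supp y) <= m)%N] = ~` [set y | (m < size (supp y))%N].
  apply/seteqP; split=> y /=; last by move/negP; rewrite -leqNgt.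
  by move=> le lt; have := leq_ltn_trans le lt; rewrite ltnn.
apply: open_closedC; rewrite openE => y /= my.
have [|e [e1 _ _ eI Te]] := @supp_bumps y (fun=> setT).
  by move=> x _; split=> //; exact: openT.
have : \forall z \near y, forall x, x \in supp y -> T (e x) z != 0.
  apply: near_seq => x xy; apply: near_neq0; first exact: T_continuous.
  by rewrite Te//; exact: lam_neq0.
apply: filterS => z Tz; apply: leq_trans my _.
have [|p [pz _ pI]] := bump_matching (supp_uniq y) eI (t := supp z).
  by move=> x /Tz/T_neq0.
rewrite -(size_map p); apply: uniq_leq_size; first by rewrite map_inj_in_uniq.
by move=> _ /mapP[x xy ->]; exact: pz.
Qed.

Lemma zero_set_closed (f : Y -> R) : continuous f -> closed [set y | f y = 0].
Proof.
move=> fc; have -> : [set y | f y = 0] = [set y | 0 <= - `|f y|].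
  apply/seteqP; split=> y /=; first by move=> ->; rewrite normr0 oppr0.
  by rewrite oppr_ge0 normr_le0 => /eqP.
by apply: closed_nonneg => y; apply: cvgN; apply: cvg_norm; exact: fc.
Qed.

(** The support lies in [F] exactly when [T f y = 0] for all [f] vanishing on [F]; a bump at a
    support point outside [F] shows the less obvious half. *)
Lemma supp_in_closed (F : set X) : closed F ->
  closed [set y | forall x, x \in supp y -> F x].
Proof.
move=> clF.
have -> : [set y | forall x, x \in supp y -> F x] =
    \bigcap_(f in [set f : Cp R X | forall x, F x -> f x = 0])
      [set y | T f y = 0].
  apply/seteqP; split=> y /= yF.
    move=> f /= f0; rewrite T_supp big1_seq// => x /= xy.
    by rewrite f0 ?mulr0//; exact: yF.
  move=> x xy; apply: contrapT => nFx.
  have [|e [e1 _ eF eI Te]] :=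
      @supp_bumps y (fun z => if z == x then ~` F else setT).
    move=> z _; case: eqP => [->|_]; last by split=> //; exact: openT.
    by split=> //; exact: closed_openC.
  have := yF (e x); rewrite /= Te// => H; have := lam_neq0 xy.
  rewrite H ?eqxx// => z Fz; apply: contrapT => /eqP /(eF _ _ xy).
  by rewrite eqxx.
by apply: closed_bigI => f _; apply: zero_set_closed; exact: T_continuous.
Qed.

(** The norm is bounded here instead of the coefficients because this is an intersection of closed
    conditions on [y]. *)
Lemma norm_le_closed (r : R) :
  closed [set y | forall f : Cp R X, (forall x, `|f x| <= 1) -> `|T f y| <= r].
Proof.
have -> : [set y | forall f : Cp R X, (forall x, `|f x| <= 1) -> `|T f y| <= r] =
    \bigcap_(f in [set f : Cp R X | forall x, `|f x| <= 1])
      [set y | - r <= - `|T f y|].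
  by apply/seteqP; split=> y /= yr f /= /yr /=; rewrite lerN2.
apply: closed_bigI => f _; apply: closed_nonneg => y.
by apply: cvgN; apply: cvg_norm; exact: T_continuous.
Qed.

Lemma norm_le_lam (r : R) y :
  (forall f : Cp R X, (forall x, `|f x| <= 1) -> `|T f y| <= r) ->
  forall x, x \in supp y -> `|lam y x| <= r.
Proof.
move=> yr x xy; have [|e [_ e01 _ _ Te]] := @supp_bumps y (fun=> setT).
  by move=> z _; split=> //; exact: openT.
rewrite -Te//; apply: yr => z; have /andP[e0 e1] := e01 x z.
by rewrite ger0_norm.
Qed.

Lemma norm_le_exists y : exists n : nat,
  forall f : Cp R X, (forall x, `|f x| <= 1) -> `|T f y| <= n%:R.
Proof.
pose N := \sum_(x <- supp y) `|lam y x|.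
have N0 : 0 <= N by exact: sumr_ge0.
exists (Num.truncn N).+1 => f f1.
have /andP[_ /ltW] := Num.Theory.truncn_itv N0; apply: le_trans.
rewrite T_supp; apply: le_trans (ler_norm_sum _ _ _) _.
apply: ler_sum => x _; rewrite normrM; have := f1 x; have := normr_ge0 (lam y x).
by move=> a b; rewrite -[leRHS]mulr1; apply: ler_wpM2l.
Qed.

(** A Lebesgue number for the cover: the functions [T f] separate points, so on the compact [C]
    finitely many of them control membership in the [U i]. Compactness is used first with [y] fixed,
    then over [y]. *)
Lemma finite_tests (C : set Y) (I : Type) (U : I -> set Y) : compact C ->
  (forall i, open (U i)) -> C `<=` \bigcup_i U i ->
  exists L : seq (Cp R X), forall y, C y -> exists i, forall z, C z ->
    (forall f, f \in L -> `|T f y - T f z| < 1) -> U i z.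
Proof.
move=> /compact_near_coveringP cC oU CU.
have local y : C y -> exists i (L : seq (Cp R X)), forall z, C z ->
    (forall f, f \in L -> `|T f y - T f z| < 1) -> U i z.
  move=> /CU[i _ Uy]; exists i.
  have [|L _ /(_ L)] := cC _ (@supersets (Cp R X)) (fun L z =>
      (forall f, f \in L -> `|T f y - T f z| < 1) -> U i z) (@supersets_filter _).
    move=> x Cx; have [Ux|nUx] := pselect (U i x).
      exists (U i, setT) => /=; last by move=> [z L] /= [].
      by split; [exact: open_nbhs_nbhs|exists [::]].
    have /T_separates[f fyx] : y <> x by move=> yx; apply: nUx; rewrite -yx.
    have d0 : T f y - T f x != 0 by rewrite subr_eq0; apply/eqP.
    (* With values at [y] and [x] exactly 2 apart, no [z] is within 1 of both. *)
    pose g := (2 / (T f y - T f x)) *: f.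
    have gyx : T g y - T g x = 2.
      by rewrite /g !T_scale -mulrBr mulfVK.
    exists ([set z | `|T g x - T g z| < 1], [set L : seq (Cp R X) | g \in L]) => /=.
      split; first exact: near_close.
      by exists [:: g] => // L; apply; exact: mem_head.
    move=> [z L] /= [gxz gL] /(_ _ gL) gyz; exfalso.
    have := ler_normD (T g y - T g z) (T g z - T g x).
    rewrite addrA subrK gyx (distrC (T g z)) ger0_norm//.
    by lra.
  by move=> sub; exists L => z Cz; apply: (sub (fun _ => id)).
have [|L _ /(_ L)] := cC _ (@supersets (Cp R X)) (fun L y =>
    exists i, forall z, C z ->
      (forall f, f \in L -> `|T f y - T f z| < 1) -> U i z) (@supersets_filter _).
  move=> y /local[i [L yL]].
  (* Doubling the tests bounds the distance from [t] to [z] by 1/2, which leaves 1/2 for the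
     distance from [y] to [t]. *)
  exists ([set t | forall f, f \in L -> `|T f y - T f t| < 1 / 2],
    [set M : seq (Cp R X) | {subset [seq 2 *: f | f <- L] <= M}]) => /=.
    split; last by exists [seq 2 *: f | f <- L].
    by apply: near_seq => f _; apply: near_close; [exact: T_continuous|lra].
  move=> [t M] /= [yt LM]; exists i => z Cz tz; apply: yL => // f fL.
  have := tz (2 *: f) (LM _ (map_f _ fL)); rewrite !T_scale -mulrBr normrM.
  rewrite (ger0_norm (x := 2))// => tz2; have := yt _ fL.
  by have := ler_normD (T f y - T f t) (T f t - T f z); rewrite addrA subrK; lra.
by move=> sub; exists L => y Cy; exact: (sub (fun _ => id)).
Qed.

Lemma supp_enum m y (x : 'I_m -> X) (F : X -> R) : size (supp y) = m ->
  injective x -> (forall a, x a \in supp y) ->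
  \sum_(z <- supp y) F z = \sum_a F (x a).
Proof.
move=> sy xI xy.
have us : uniq [seq x a | a <- enum 'I_m] by rewrite map_inj_uniq ?enum_uniq.
have sub : {subset [seq x a | a <- enum 'I_m] <= supp y}.
  by move=> _ /mapP[a _ ->].
have [_ eqs] := uniq_min_size us sub
  (eq_leq (etrans sy (esym (etrans (size_map _ _) (size_enum_ord m))))).
rewrite -(perm_big _ (uniq_perm us (supp_uniq y) eqs)) big_map.
by rewrite big_enum.
Qed.

(** The quotient is [(lam y x * f x) ^+ 2] over [lam y x * (f x) ^+ 2]. It yields the coefficient
    from values of [T] at [y] alone, without knowing [x] or [f x]. *)
Lemma lam_ratio y x (f : Cp R X) : x \in supp y -> f x != 0 ->
  (forall z, z \in supp y -> z != x -> f z = 0) ->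
  (T f y) ^+ 2 / T (Cp_square f) y = lam y x.
Proof.
move=> xy fx f0; have lx := lam_neq0 xy.
have sqE z : Cp_square f z = f z * f z by [].
rewrite (T_single xy f0) (T_single (f := Cp_square f) xy); last first.
  by move=> z zy zx; rewrite sqE f0// mulr0.
by rewrite sqE; field; apply/andP.
Qed.

(* Near [y] a point [z] of the stratum has exactly one support point in each
   bump, and [lam_ratio] recovers its coefficient from continuous functions
   of [z]. *)
Lemma matching_supports m (C : set Y) y (x : 'I_m -> X) (V : 'I_m -> set X)
    (K : 'I_m -> set R) :
  (forall z, C z -> size (supp z) = m) -> C y ->
  injective x -> (forall a, x a \in supp y) ->
  (forall a, open (V a) /\ V a (x a)) ->
  (forall a, open (K a) /\ K a (lam y (x a))) ->
  \forall z \near y, C z -> exists x' : 'I_m -> X, [/\ injective x',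
    forall a, x' a \in supp z, forall a, V a (x' a) &
    forall a, K a (lam z (x' a))].
Proof.
(* The neighbourhoods, indexed by ['I_m], are re-indexed by points: as [x] is injective, the
   intersection is [V a] at [x a] and the whole space at a point that is no [x a]. *)
move=> Cm Cy xI xy VP KP.
have [|e [e1 _ eV eI Te]] :=
    @supp_bumps y (fun t => \bigcap_(a in [set a | x a = t]) V a).
  move=> t ty; split; last by move=> a /= <-; have [] := VP a.
  have [[a xa]|nx] := pselect (exists a, x a = t).
    have -> : \bigcap_(a in [set a | x a = t]) V a = V a.
      apply/seteqP; split=> z /=; first by apply.
      by move=> Vz b /= xb; rewrite (xI b a) // xa.
    by have [] := VP a.
  have -> : \bigcap_(a in [set a | x a = t]) V a = setT.
    by apply/seteqP; split=> // z _ a /= xa; case: nx; exists a.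
  exact: openT.
have e0 a z : z \in supp y -> z != x a -> e (x a) z = 0.
  move=> zy zx; apply/eqP; apply: contraNT zx => ez; apply/eqP/esym.
  by apply: (eI _ _ z) => //; rewrite e1// oner_neq0.
have exa a : e (x a) (x a) != 0 by rewrite e1// oner_neq0.
have nearT : \forall z \near y, forall a, T (e (x a)) z != 0.
  apply: filter_forall => a; apply: near_neq0; first exact: T_continuous.
  by rewrite Te//; exact: lam_neq0.
have nearK : \forall z \near y, forall a,
    K a ((T (e (x a)) z) ^+ 2 / T (Cp_square (e (x a))) z).
  apply: filter_forall => a.
  have sq0 : T (Cp_square (e (x a))) y != 0.
    rewrite (T_single (x := x a))//.
      by rewrite !mulf_neq0// lam_neq0.
    by move=> z zy zx; rewrite [LHS](_ : _ = e (x a) z * e (x a) z)// e0// mulr0.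
  have Ty f : T f z @[z --> y] --> T f y by exact: T_continuous.
  have := cvgM (cvgM (Ty (e (x a))) (Ty (e (x a))))
    (cvgV sq0 (Ty (Cp_square (e (x a))))).
  apply; apply: open_nbhs_nbhs; have [oK Kl] := KP a; split=> //.
  by rewrite -expr2 (lam_ratio (x := x a))//; exact: e0.
near=> z => Cz.
have Tz : forall a, T (e (x a)) z != 0 by near: z.
have Kz : forall a, K a ((T (e (x a)) z) ^+ 2 / T (Cp_square (e (x a))) z).
  by near: z.
have /choice[x' x'P] : forall a, exists t, t \in supp z /\ e (x a) t != 0.
  by move=> a; have [t tz et] := T_neq0 (Tz a); exists t.
have x'I : injective x'.
  move=> a b ab; apply: xI; have [_ ea] := x'P a; have [_ eb] := x'P b.
  by apply: (eI _ _ (x' a)) => //; rewrite ab.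
have x'z a : x' a \in supp z by have [] := x'P a.
have ex' a : e (x a) (x' a) != 0 by have [] := x'P a.
exists x'; split=> // a; first by apply: (eV _ _ (xy a) (ex' a)).
rewrite -(lam_ratio (f := e (x a)) (x'z a))// => t tz tx.
(* Otherwise [t] and the points [x' b] would be [m + 1] support points of [z]. *)
have [b tb] : exists b, t = x' b.
  apply: contrapT => nb.
  have us : uniq (t :: [seq x' b | b <- enum 'I_m]).
    rewrite /= map_inj_uniq ?enum_uniq// andbT.
    by apply/mapP => -[b _ tb]; apply: nb; exists b.
  have : (size (t :: [seq x' b | b <- enum 'I_m]) <= size (supp z))%N.
    apply: uniq_leq_size => // u; rewrite inE => /predU1P[->//|/mapP[b _ ->]].
    exact: x'z.
  by rewrite Cm//= size_map size_enum_ord ltnn.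
apply/eqP; apply: contraNT tx => et; rewrite tb; apply/eqP; congr x'; apply: xI.
by apply: (eI _ _ t) => //; rewrite tb; exact: ex'.
Unshelve. all: by end_near. Qed.

(** A union bound, by double counting the pairs of a point and a choice. *)
Lemma cover_choices_card m n (C : finType) (s : seq X) (S : X -> pred C) :
  (size s <= m)%N -> (forall x, x \in s -> (#|S x| <= n)%N) ->
  (#|[pred c | has (S^~ c) s]| <= m * n)%N.
Proof.
move=> sm Sn; apply: leq_trans (leq_mul sm (leqnn n)).
rewrite -sum1_card.
apply: (@leq_trans (\sum_c \sum_(x <- s) (S x c : nat))).
  rewrite big_mkcond /=; apply: leq_sum => c _; case: ifP => // /hasP[x xs Sx].
  by rewrite (big_rem x xs) /= Sx.
rewrite exchange_big /=; apply: (@leq_trans (\sum_(x <- s) n)); last first.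
  by rewrite big_const_seq count_predT iter_addn_0 mulnC.
rewrite big_seq [leqRHS]big_seq; apply: leq_sum => x /Sn; apply: leq_trans.
rewrite -sum1_card [leqRHS]big_mkcond; apply: leq_sum => c _.
by rewrite unfold_in; case: (S x c).
Qed.

(** A member is indexed by [c], which assigns to each of the [m] support points a set of the cover
    of [F] and an interval for its coefficient. At a given [y] every value of [c] is one of at most
    [m * (n * 2)] pairs, whence the bound, whatever the fineness. *)
Lemma stratum_dim_lt m n (r : R) (F : set X) (C : set Y) :
  compact F -> dim_lt n F -> compact C ->
  (forall y, C y -> size (supp y) = m) ->
  (forall y x, C y -> x \in supp y -> F x) ->
  (forall y x, C y -> x \in supp y -> `|lam y x| <= r) ->
  dim_lt ((m * (n * 2)) ^ m) C.
Proof.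
move=> cF dF cC Cm CF Cr; apply: dim_lt_relative => I U oU CU.
have [L LP] := finite_tests cC oU CU.
have [M [M0 MP]] := compact_seq_bounded L cF.
(* Each of the [m] terms of [T f y - T f z] is at most [(|r| + M) * d]; the summand 1 makes [d]
   positive and the total strictly less than 1. *)
pose d := (m%:R * (`|r| + M) + 1)^-1.
have B0 : 0 <= m%:R * (`|r| + M) by rewrite mulr_ge0// addr_ge0.
have d0 : 0 < d by rewrite invr_gt0; lra.
have [J1 [V [oV FV Vd Vn]]] := small_oscillation_cover L d0 dF.
have [J2 [K [oK rK Kd K2]]] := interval_cover r d0.
pose W (c : {ffun 'I_m -> J1 * J2}) y := exists x : 'I_m -> X, [/\ injective x,
  forall a, x a \in supp y, forall a, V (c a).1 (x a) &
  forall a, K (c a).2 (lam y (x a))].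
exists {ffun 'I_m -> J1 * J2}, W; split.
- move=> c y Cy [x [xI xy xV xK]].
  exact: (matching_supports (V := fun a => V (c a).1)
    (K := fun a => K (c a).2) Cm Cy xI xy).
- move=> y Cy; pose x a := tnth (Tuple (introT eqP (Cm _ Cy))) a.
  have xy a : x a \in supp y by exact: mem_tnth.
  have /choice[p pP] : forall a, exists p, V p.1 (x a) /\ K p.2 (lam y (x a)).
    move=> a; have [j1 _ ?] := FV _ (CF _ _ Cy (xy a)).
    by have [j2 _ ?] := rK _ (Cr _ _ Cy (xy a)); exists (j1, j2).
  exists [ffun a => p a] => //; exists x; split=> // [|a|a].
  + by apply/tuple_uniqP; exact: supp_uniq.
  + by rewrite ffunE; have [] := pP a.
  + by rewrite ffunE; have [] := pP a.
- move=> c y Cy [x [xI xy xV xK]].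
  have [i iP] := LP _ Cy; exists i => z Cz [x' [x'I x'z x'V x'K]].
  apply: iP => // f fL.
  rewrite !T_supp (supp_enum _ (Cm _ Cy) xI xy) (supp_enum _ (Cm _ Cz) x'I x'z).
  rewrite -sumrB; apply: le_lt_trans (ler_norm_sum _ _ _) _.
  apply: (@le_lt_trans _ _ (\sum_(a < m) (`|r| + M) * d)).
    apply: ler_sum => a _.
    have -> : lam y (x a) * f (x a) - lam z (x' a) * f (x' a) =
        lam y (x a) * (f (x a) - f (x' a)) +
        (lam y (x a) - lam z (x' a)) * f (x' a) by ring.
    apply: le_trans (ler_normD _ _) _; rewrite !normrM mulrDl [M * d]mulrC.
    apply: lerD; apply: ler_pM => //.
    + by apply: le_trans (Cr _ _ Cy (xy a)) _; exact: ler_norm.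
    + exact/ltW/(Vd _ _ _ _ (xV a) (x'V a)).
    + exact/ltW/(Kd _ _ _ (xK a) (x'K a)).
    + exact: MP _ _ fL (CF _ _ Cz (x'z a)).
  rewrite sumr_const card_ord -mulr_natl mulrA /d.
  by rewrite ltr_pdivrMr ?mul1r; lra.
- move=> y Cy.
  pose S x := [pred p : J1 * J2 | `[< V p.1 x >] && `[< K p.2 (lam y x) >]].
  pose A := [pred p | has (S^~ p) (supp y)].
  have cA : (#|A| <= m * (n * 2))%N.
    apply: cover_choices_card => [|x xy]; first by rewrite Cm.
    have -> : #|S x| = (cover_order V x * cover_order K (lam y x))%N.
      by rewrite -cardX; apply: eq_card => p; rewrite !inE.
    by apply: leq_mul => //; apply: Vn; exact: CF xy.
  apply: (@leq_trans #|@ffun_on_mem 'I_m (J1 * J2)%type (mem A)|); last first.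
    rewrite card_ffun_on card_ord.
    (* Powers are compared by their bases for a positive exponent only; for [m = 0] both are 1. *)
    have [m0|m0] := posnP m; last by rewrite leq_exp2r.
    by rewrite [X in (_ ^ X <= _)%N]m0 [X in (_ <= _ ^ X)%N]m0.
  apply/subset_leq_card/fintype.subsetP => c; rewrite inE => /asboolP.
  move=> [x [xI xy xV xK]]; apply/ffun_onP => a; rewrite inE; apply/hasP.
  by exists (x a) => //; rewrite inE; apply/andP; split; apply/asboolP.
Qed.

End strata.

(** * Gluing the strata *)

Section strata_union.
Context (R : realType) (X Y : topologicalType) (T : Cp R X -> Y -> R)
  (supp : Y -> seq X) (lam : Y -> X -> R).
Context (tX : tychonoff_space X) (crY : completely_regular_space Y)
  (T_continuous : forall f, continuous (T f))
  (supp_uniq : forall y, uniq (supp y))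
  (lam_neq0 : forall y x, x \in supp y -> lam y x != 0)
  (T_supp : forall y f, T f y = \sum_(x <- supp y) lam y x * f x)
  (T_separates : forall y z, y <> z -> exists f, T f y <> T f z).

(** Induction on [m]: the points with support size at most [m] form a compact subset of those with
    size at most [m + 1], and compact subsets of the difference lie in a single stratum. *)
Lemma supp_size_le_dim_lt n (r : R) (F : set X) (A : set Y) :
  compact F -> dim_lt n F -> compact A ->
  (forall y x, A y -> x \in supp y -> F x) ->
  (forall y x, A y -> x \in supp y -> `|lam y x| <= r) ->
  forall m, exists N, dim_lt N (A `&` [set y | (size (supp y) <= m)%N]).
Proof.
move=> cF dF cA AF Ar m.
have cAm k : compact (A `&` [set y | (size (supp y) <= k)%N]).
  apply: compact_closedI => //.
  exact: (supp_size_closed (T := T) (lam := lam)).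
have stratum k (C : set Y) : compact C -> C `<=` A ->
    (forall y, C y -> size (supp y) = k) -> dim_lt ((k * (n * 2)) ^ k) C.
  move=> cC CA Ck.
  apply: (stratum_dim_lt tX T_continuous supp_uniq lam_neq0 T_supp T_separates
    cF dF cC Ck); first by move=> y x /CA; exact: AF.
  by move=> y x /CA; exact: Ar.
elim: m => [|m [N dN]].
  exists ((0 * (n * 2)) ^ 0)%N; apply: stratum => // y [_ /=].
  by rewrite leqn0 => /eqP.
exists (N + (m.+1 * (n * 2)) ^ m.+1)%N.
apply: (dim_lt_glue R crY (cAm m.+1) (cAm m)) => //.
  by move=> y [Ay /= /leqW]; split.
move=> C cC CA; apply: stratum => // y /CA[[Ay /= ym] nym] //.
apply/eqP; rewrite eqn_leq ym ltnNge; apply/negP => le; exact: nym.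
Qed.

End strata_union.

(** * Decomposition of the target space *)

Definition seq_union (I X : Type) (A : I -> set X) (s : seq I) : set X :=
  foldr (fun i B => A i `|` B) set0 s.

Lemma seq_union_map (I X : Type) (J : eqType) (A : I -> set X) (q : J -> I)
    (s : seq J) (j : J) (x : X) :
  j \in s -> A (q j) x -> seq_union A (map q s) x.
Proof.
elim: s => //= i s IHs; rewrite inE => /predU1P[->|js] Ax; first by left.
by right; exact: IHs.
Qed.

Lemma seq_union_dim_lt (R : realType) (X : topologicalType) (I : Type)
    (s : seq I) (A : I -> set X) :
  completely_regular_space X -> (forall i, compact (A i)) ->
  (forall i, exists n, dim_lt n (A i)) ->
  compact (seq_union A s) /\ exists n, dim_lt n (seq_union A s).
Proof.
move=> crX cA dA; elim: s => [|i s [cs [n dn]]] /=.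
  split; first exact: compact0.
  by exists 0%N => I' U _ _; exists void, (fun=> set0); split=> // -[].
split; first exact: compactU.
have [m dm] := dA i; exists (m + n)%N.
exact: (dim_lt_union R crX (cA i) cs dm dn).
Qed.

Theorem theorem3p11 (R : realType) (K : Type) (hK : [set: nat] #<= [set: K])
    (X Y : topologicalType) (hX : tychonoff_space X) (hY : tychonoff_space Y)
    (cX : kappa_compact K X) (cY : kappa_compact K Y)
    (hT : exists T : {linear Cp R X -> Cp R Y},
      continuous T /\ dense (range T)) :
  strongly_kappa_dimensional R K X -> strongly_kappa_dimensional R K Y.
Proof.
move=> [F [clF dF Fcov]].
have [T [Tc dT]] := hT; have [P [cP Pcov]] := cX; have [Q [cQ Qcov]] := cY.
have [crX hausX] := hX; have [crY hausY] := hY.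
have /choice[supp suppP] : forall y, exists s : seq X, exists l : X -> R,
    [/\ uniq s, forall x, x \in s -> l x != 0 &
      forall f, T f y = \sum_(x <- s) l x * f x].
  by move=> y; exact: functional_support.
have /choice[lam lamP] := suppP.
pose T' (f : Cp R X) y := T f y.
have T'c f : continuous (T' f) by exact: Cp_continuous.
have us y : uniq (supp y) by have [] := lamP y.
have l0 y x : x \in supp y -> lam y x != 0 by have [_ + _] := lamP y; exact.
have T'E y f : T' f y = \sum_(x <- supp y) lam y x * f x.
  by have [_ _ +] := lamP y; exact.
have T'sep y z : y <> z -> exists f, T' f y <> T' f z.
  exact: dense_range_separates.
have {suppP} [h hsurj] := index_surjection hK.
(* Pieces of [X] that are both compact and finite-dimensional. *)
pose A (p : K * K) := P p.1 `&` F p.2.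
have cA p : compact (A p) by exact: compact_closedI.
have dA p : exists n, dim_lt n (A p).
  have [n dn] := dF p.2; exists n.+1.
  by apply: (dim_le_dim_lt crX (cA p) _ dn) => x [].
have UP s : compact (seq_union A s) /\ exists n, dim_lt n (seq_union A s).
  exact: seq_union_dim_lt.
(* An index records a compact piece of [Y], a list of pieces of [X] that contains the support, a
   bound on the support size, and a bound on the norm. *)
pose B (i : K * seq (K * K) * nat * nat) := Q i.1.1.1 `&`
  [set y | forall x, x \in supp y -> seq_union A i.1.1.2 x] `&`
  [set y | forall f : Cp R X, (forall x, `|f x| <= 1) -> `|T' f y| <= i.2%:R].
pose G (i : K * seq (K * K) * nat * nat) :=
  B i `&` [set y | (size (supp y) <= i.1.2)%N].
have cB i : compact (B i).
  apply: compact_closedI; last exact: norm_le_closed.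
  apply: compact_closedI; first exact: cQ.
  apply: (supp_in_closed (T := T') (lam := lam)) => //.
  by apply: compact_closed => //; have [] := UP i.1.1.2.
have cG i : compact (G i).
  apply: compact_closedI; first exact: cB.
  exact: (supp_size_closed (T := T') (lam := lam)).
exists (fun k => G (h k)); split=> [k|k|].
- by apply: compact_closed => //; exact: cG.
- set i := h k; have [cU [n dU]] := UP i.1.1.2.
  have [||N dN] := supp_size_le_dim_lt (T := T') (lam := lam) (n := n)
    (r := i.2%:R) hX crY T'c us l0 T'E T'sep cU dU (cB i) _ _ i.1.2.
  + by move=> y x [[_ yU] _]; exact: yU.
  + by move=> y x [_ yr]; apply: (norm_le_lam (T := T')).
  (* Dimension at most [N] corresponds to order at most [N + 1], so the bound is relaxed by one. *)
  exists N; apply: dim_lt_dim_le => //.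
  by move=> I V oV GV; have [J [W [oW GW WV WN]]] := dN I V oV GV;
    exists J, W; split=> // z Gz; apply: leqW; exact: WN.
- apply/seteqP; split=> // y _.
  have [j _ Qy] : (\bigcup_k Q k) y by rewrite Qcov.
  have /choice[q qP] : forall x, exists p, A p x.
    move=> x; have [a _ Px] : (\bigcup_k P k) x by rewrite Pcov.
    by have [b _ Fx] : (\bigcup_k F k) x; [rewrite Fcov|exists (a, b)].
  have [r yr] := norm_le_exists T'E y.
  (* The support being finite, the pieces that contain its points form a list, which is part of the
     index covering [y]. *)
  have [k hk] := hsurj (j, map q (supp y), size (supp y), r).
  exists k => //; rewrite hk; split=> //=; split=> //; split=> // x xy.
  exact: seq_union_map xy (qP x).
Qed.
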